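(* Let $m\in\mathbb{N}\cup\{\infty\}$, let $k_1,\dots,k_s\in\{1,\dots,m\}$ (finite labels) be distinct, and let $t_1,\dots,t_s\in\mathbb{N}$. The invariant $\theta_{t_1,\ldots,t_s}[m|k_1,\ldots,k_s]$ is represented by a combinatorial formula in the lattice: there is an integer combination $F_{t_1,\ldots,t_s}[m|k_1,\ldots,k_s]$ of diagrams in $\vec{\mathscr{A}}[m]$ such that $$\langle F_{t_1,\ldots,t_s}[m|k_1,\ldots,k_s],\cdot\rangle\in\mathrm{Hom}_{\mathbb{Z}}(\vec{\mathscr{X}}_{t_1+\cdots+t_s}[m],\mathbb{Q})$$ and $\theta_{t_1,\ldots,t_s}[m|k_1,\ldots,k_s]\circ\Lambda[m]=\langle F_{t_1,\ldots,t_s}[m|k_1,\ldots,k_s],I[m]\circ\Lambda[m](\cdot)\rangle$. Hence, when $P$ is the Gaussian parity, the columns of the lattice represent an infinite dimensional space of Kauffman finite-type invariants: for each $t\in\mathbb{N}$ (positive), the invariants $v\circ I[m]\circ\Lambda[m]$ with $m\in\mathbb{N}\cup\{\infty\}$ and $v\in\mathrm{Hom}_{\mathbb{Z}}(\vec{\mathscr{X}}_t[m],\mathbb{Q})$ span an infinite dimensional rational vector space.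
   Context: Gauss diagrams. A Gauss diagram is a fixed base (the oriented line $\mathbb{R}$ or the oriented circle $S^1$) with finitely many arrows, each with a sign $\oplus$ or $\ominus$, all endpoints distinct, up to orientation-preserving homeomorphism. $C(D)$ is the set of arrows. An arrow is isolated if its endpoints are consecutive; two arrows are linked if their endpoints alternate. (Long) virtual knots are equivalence classes of Gauss diagrams under the usual Reidemeister moves. In particular the move $\Omega 3$: given three disjoint intervals $1,2,3$ of the base (in any order) and three arrows of equal sign, $1\to2$, $1\to3$, $2\to3$, whose endpoints occur on interval 1 in the order $(12),(13)$, on interval 2 in the order $(12),(23)$, on interval 3 in the order $(13),(23)$ (no other endpoints there), $\Omega 3$ reverses the order of the two endpoints on each interval (and the inverse move). Labels. $P$ is the Gaussian parity: an arrow is odd (even) if it is linked with an odd (even) number of arrows. $f(D)$ deletes all odd arrows of $D$. With $\infty+1=\infty$, the $f^m$-label of $x\in C(D)$ is the least $i$, $1\le i\le m$, with $x\notin C(f^i(D))$, and $m+1$ if there is none. Groups. $\vec{\mathscr{A}}[m]$ is the set of signed arrow diagrams, i.e. Gauss diagrams each of whose arrows carries an arbitrary label in $\{1,\dots,m+1\}$ (in $\{1,2,\dots\}\cup\{\infty\}$ if $m=\infty$). Relations: $\vec{\mathrm{Q1}}[m]$: $D=0$ if $D$ has an isolated arrow labelled $m+1$. $\vec{\mathrm{Q2}}[m]$: $D+(D\setminus a)+(D\setminus b)=0$ if $a,b$ have opposite signs, equal labels, adjacent tails and adjacent heads. $\vec{\mathrm{Q3}}[m]$: if $D,D'$ are related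 by $\Omega 3$ with corresponding arrows $a,b,c$ of equal sign having the same labels $i,j,k$ in $D$ and $D'$, where $i>j=k$, or $j>i=k$, or $k>i=j$, or $i=j=k=m+1$, then $D+(D\setminus a)+(D\setminus b)+(D\setminus c)=D'+(D'\setminus a)+(D'\setminus b)+(D'\setminus c)$. $\vec{\mathscr{X}}_t[m]$ is $\mathbb{Z}[\vec{\mathscr{A}}[m]]$ modulo these relations and all diagrams with more than $t$ arrows. The lattice consists of the groups $\vec{\mathscr{X}}_t[m]$; its $t$-th column consists of the $\vec{\mathscr{X}}_t[m]$ with $m$ varying. $\Lambda[m](D)$ is $D$ with its $f^m$-labelling; $I[m](D)=\sum_{F\subseteq D}F$ over all subdiagrams (subsets of arrows, keeping signs and labels). $\langle\cdot,\cdot\rangle$ is the bilinear pairing with $\langle D,E\rangle=\delta_{DE}$ on diagrams. Elements of $\mathrm{Hom}_{\mathbb{Z}}(\vec{\mathscr{X}}_t[m],\mathbb{Q})$ are regarded as maps on $\mathbb{Z}[\vec{\mathscr{A}}[m]]$. For $D\in\vec{\mathscr{A}}[m]$, $\theta[m|k](D)$ is the number of arrows of $D$ signed $\oplus$ and labelled $k$ minus the number signed $\ominus$ and labelled $k$, and $\theta_{t_1,\ldots,t_s}[m|k_1,\ldots,k_s](D)=\prod_{j=1}^s(\theta[m|k_j](D))^{t_j}$. Kauffman finite-type invariant of degree $\le n$: an invariant $w$ such that for every $D$ and every set $S$ of more than $n$ arrows, $\sum_{T\subseteq S}(-1)^{|T|}w(D_T)=0$, where $D_T$ is obtained from $D$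 by reversing sign and direction of the arrows in $T$. *)

(* Defs.v *)
(* MathComp world, with classical logic from mathcomp.classical.boolp. *)
From HB Require Import structures.
From mathcomp Require Import all_boot all_order all_algebra finmap boolp.
From mathcomp Require Import freeg.
From Stdlib Require Import Relation_Operators.

Set Implicit Arguments.
Unset Strict Implicit.
Unset Printing Implicit Defensive.

Import GRing.Theory.
Local Open Scope fset_scope.
Local Open Scope quotient_scope.
Local Open Scope ring_scope.

(* The oriented line, or the oriented circle cut open at a point.  In both
   cases the endpoints of arrows are coded by natural numbers in increasing
   order; on the circle only their cyclic order matters. *)
Inductive base : Set := Line | Circle.

(* (tail, head, sign, label); the sign plus is [true]. *)
Definition arrow (L : choiceType) : Type := (nat * nat * bool * L)%type.

Section Raw.
Variable L : choiceType.
Implicit Types (a : arrow L) (A : {fset arrow L}) (p q x : nat).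

Definition tail_of a : nat := a.1.1.1.
Definition head_of a : nat := a.1.1.2.
Definition sign_of a : bool := a.1.2.
Definition label_of a : L := a.2.
Definition endpoint a (e : bool) : nat := if e then head_of a else tail_of a.

Definition distinct_endpoints A : Prop :=
  {in A &, forall a a' e e', endpoint a e = endpoint a' e' -> (a, e) = (a', e')}.

(* A diagram with actual coordinates; diagrams up to homeomorphism are the
   quotient [diagram] below. *)
Definition raw : Type := {A : {fset arrow L} | `[< distinct_endpoints A >]}.

Lemma rawP (D : raw) : distinct_endpoints (val D).
Proof. by case: D => A /= /asboolP. Qed.

Definition endpoints A : {fset nat} :=
  [fset tail_of a | a in A] `|` [fset head_of a | a in A].

Lemma endpointsP A x :
  reflect (exists2 a, a \in A & exists e, x = endpoint a e) (x \in endpoints A).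
Proof.
apply: (iffP idP) => [|[a aA [e ->]]].
  rewrite in_fsetU => /orP[] /imfsetP[a /= aA ->]; exists a => //.
    by exists false.
  by exists true.
rewrite in_fsetU; apply/orP.
by case: e; [right | left]; apply/imfsetP; exists a.
Qed.

Lemma keep_subproof (P : pred (arrow L)) (D : raw) :
  `[< distinct_endpoints [fset a in val D | P a] >].
Proof.
apply/asboolP => a a'; rewrite !inE => /andP[aD _] /andP[a'D _].
exact: (rawP aD a'D).
Qed.

Definition keep (P : pred (arrow L)) (D : raw) : raw :=
  exist _ [fset a in val D | P a] (keep_subproof P D).

Definition delete (D : raw) a : raw := keep (predC1 a) D.

Definition subdiagram (D : raw) (F : {fset arrow L}) : raw :=
  keep [pred a | a \in F] D.

(* [x] lies in the open arc of the base running from [p] to [q]. *)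
Definition in_arc (b : base) p q x : bool :=
  match b with
  | Line => (p < x < q)%N
  | Circle => [|| (p < x < q)%N, (x < q < p)%N | (q < p < x)%N]
  end.

(* [q] is the endpoint that immediately follows [p] along the base. *)
Definition follows b (D : raw) p q : bool :=
  [&& p \in endpoints (val D), q \in endpoints (val D),
      (if b is Line then p < q else p != q)%N &
      ~~ has (in_arc b p q) (endpoints (val D))].

Definition adjacent b (D : raw) p q : bool := follows b D p q || follows b D q p.

Definition isolated b (D : raw) a : bool := adjacent b D (tail_of a) (head_of a).

Definition linked a a' : bool :=
  let between x := (minn (tail_of a) (head_of a) < x < maxn (tail_of a) (head_of a))%N in
  between (tail_of a') (+) between (head_of a').

Definition move_arrow (phi : nat -> nat) a : arrow L :=
  (phi (tail_of a), phi (head_of a), sign_of a, label_of a).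

(* The restrictions of orientation preserving homeomorphisms of the base to a
   finite set of points. *)
Definition orientation_preserving b (phi : nat -> nat) (E : {fset nat}) : Prop :=
  match b with
  | Line => {in E &, {mono phi : p q / (p < q)%N}}
  | Circle => {in E &, injective phi} /\
      {in E & &, forall p q x,
        in_arc Circle (phi p) (phi q) (phi x) = in_arc Circle p q x}
  end.

Definition homeomorphic b (D D' : raw) : Prop :=
  exists2 phi, orientation_preserving b phi (endpoints (val D)) &
               val D' = [fset move_arrow phi a | a in val D].

Lemma orientation_preserving_inj b phi E :
  orientation_preserving b phi E -> {in E &, injective phi}.
Proof.
case: b => [mono|[]//] p q pE qE eq_pq.
case: (ltngtP p q) => //; first by rewrite -mono // eq_pq ltnn.
by rewrite -mono // eq_pq ltnn.
Qed.

Lemma endpoint_move phi a e : endpoint (move_arrow phi a) e = phi (endpoint a e).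
Proof. by case: e. Qed.

Lemma homeomorphic_refl b : forall D, homeomorphic b D D.
Proof.
move=> D; exists id; first by case: b => //=; split.
apply/fsetP => -[[[t h] s] l]; apply/idP/imfsetP => [aD|[[[[t' h'] s'] l']]].
  by exists (t, h, s, l).
by rewrite /move_arrow /tail_of /head_of /sign_of /label_of /= => aD ->.
Qed.

Lemma homeomorphic_trans b D2 D1 D3 :
  homeomorphic b D1 D2 -> homeomorphic b D2 D3 -> homeomorphic b D1 D3.
Proof.
move=> [phi hphi e2] [psi hpsi e3].
have im x : x \in endpoints (val D1) -> phi x \in endpoints (val D2).
  case/endpointsP => a aD [e ->]; apply/endpointsP; rewrite e2.
  exists (move_arrow phi a); last by exists e; rewrite endpoint_move.
  by apply/imfsetP; exists a.
exists (psi \o phi).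
  case: b hphi hpsi => /= [m1 m2 p q pE qE|[i1 m1] [i2 m2]].
    by rewrite m2 ?im // m1.
  split=> [p q pE qE /i2 H|p q x pE qE xE]; first by apply: i1 => //; apply: H; exact: im.
  by rewrite m2 ?im // m1.
apply/fsetP => a; rewrite e3 e2; apply/imfsetP/imfsetP => /= -[].
  by move=> a2 /imfsetP[a1 /= a1D ->] ->; exists a1.
by move=> a1 a1D ->; exists (move_arrow phi a1) => //; apply/imfsetP; exists a1.
Qed.

Lemma homeomorphic_sym b D D' : homeomorphic b D D' -> homeomorphic b D' D.
Proof.
move=> [phi hphi e'].
have inj := orientation_preserving_inj hphi.
set E := endpoints (val D) in hphi inj.
pose psi y := nth 0%N E (index y [seq phi x | x <- E]).
have psiK : {in E, cancel phi psi}.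
  by move=> x xE; rewrite /psi nth_index_map.
have im y : y \in endpoints (val D') -> exists2 x, x \in E & y = phi x.
  case/endpointsP => a'; rewrite e' => /imfsetP[a /= aD ->] [e ->].
  exists (endpoint a e); last by rewrite endpoint_move.
  by apply/endpointsP; exists a => //; exists e.
exists psi.
  case: b hphi => /= [m|[_ m]].
    move=> _ _ /im[p pE ->] /im[q qE ->]; by rewrite !psiK // m.
  split=> [_ _ /im[p pE ->] /im[q qE ->]|_ _ _ /im[p pE ->] /im[q qE ->] /im[x xE ->]].
    by rewrite !psiK // => ->.
  by rewrite !psiK // m.
have moveK a : a \in val D -> move_arrow psi (move_arrow phi a) = a.
  move=> aD; have aE e : endpoint a e \in E by apply/endpointsP; exists a => //; exists e.
  move: (psiK _ (aE false)) (psiK _ (aE true)); case: a {aD aE} => [[[t h] s] l].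
  by rewrite /move_arrow /= /tail_of /head_of /sign_of /label_of /= => -> ->.
apply/fsetP => a; rewrite e'; apply/idP/imfsetP => [aD|[_ /imfsetP[a1 /= a1D ->] ->]].
  by exists (move_arrow phi a); [apply/imfsetP; exists a | rewrite moveK].
by rewrite moveK.
Qed.

Definition homeo b : rel raw := fun D D' => `[< homeomorphic b D D' >].

Lemma homeo_equiv b : equiv_class_of (homeo b).
Proof.
split=> [D|D D'|D2 D1 D3]; first exact/asboolP/homeomorphic_refl.
  by apply/asboolP/asboolP; exact: homeomorphic_sym.
by move=> /asboolP h1 /asboolP h2; apply/asboolP/(homeomorphic_trans h1 h2).
Qed.

Canonical homeo_equiv_rel b := EquivRelPack (homeo_equiv b).

Definition diagram b : Type := {eq_quot homeo b}.

Definition cls b (D : raw) : diagram b := \pi_(diagram b) D.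

(* The coordinate permutation of the third Reidemeister move on the arrows
   [a] : 1 -> 2, [a'] : 1 -> 3 and [a''] : 2 -> 3: it exchanges the two
   endpoints lying on each of the three intervals. *)
Definition exchange a a' a'' (x : nat) : nat :=
  [fun x => x with tail_of a |-> tail_of a', tail_of a' |-> tail_of a,
                   head_of a |-> tail_of a'', tail_of a'' |-> head_of a,
                   head_of a' |-> head_of a'', head_of a'' |-> head_of a'] x.

Definition omega3 b (D D' : raw) a a' a'' : Prop :=
  [/\ [/\ a \in val D, a' \in val D & a'' \in val D],
      sign_of a = sign_of a' /\ sign_of a' = sign_of a'',
      [/\ follows b D (tail_of a) (tail_of a'), follows b D (head_of a) (tail_of a'')
        & follows b D (head_of a') (head_of a'')] &
      val D' = [fset move_arrow (exchange a a' a'') x | x in val D]].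

Definition omega2 b (D : raw) a a' : Prop :=
  [/\ a \in val D, a' \in val D, sign_of a != sign_of a',
      adjacent b D (tail_of a) (tail_of a') & adjacent b D (head_of a) (head_of a')].

Definition odd_arrow (D : raw) a : bool :=
  odd #|` [fset a' in val D | linked a a']|.

Definition drop_odd (D : raw) : raw := keep (fun a => ~~ odd_arrow D a) D.

End Raw.

Lemma image_subproof (L L' : choiceType) (g : arrow L -> arrow L')
    (r : pred (arrow L)) (D : raw L) :
  (forall a e, endpoint (g a) e = endpoint a (r a (+) e)) ->
  `[< distinct_endpoints [fset g a | a in val D] >].
Proof.
move=> hg; apply/asboolP => _ _ /imfsetP[a /= aD ->] /imfsetP[a' /= a'D ->] e e'.
rewrite !hg => /(rawP aD a'D)[<-]; by move/addbI ->.
Qed.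

Definition gauss b : Type := diagram unit b.

Inductive reidemeister b : gauss b -> gauss b -> Prop :=
| Omega1 (D : raw unit) a of a \in val D & isolated b D a :
    reidemeister (cls b D) (cls b (delete D a))
| Omega2 (D : raw unit) a a' of omega2 b D a a' :
    reidemeister (cls b D) (cls b (delete (delete D a) a'))
| Omega3 (D D' : raw unit) a a' a'' of omega3 b D D' a a' a'' :
    reidemeister (cls b D) (cls b D').

(* Equivalence of Gauss diagrams as (long) virtual knots. *)
Definition vknot_equiv b : gauss b -> gauss b -> Prop :=
  clos_refl_sym_trans (gauss b) (@reidemeister b).

Definition vknot_invariant b (w : gauss b -> rat) : Prop :=
  forall D D', vknot_equiv D D' -> w D = w D'.

Definition reverse_in (T : {fset arrow unit}) (a : arrow unit) : arrow unit :=
  if a \in T then (head_of a, tail_of a, ~~ sign_of a, label_of a) else a.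

Lemma endpoint_reverse_in T a e :
  endpoint (reverse_in T a) e = endpoint a ((a \in T) (+) e).
Proof. by rewrite /reverse_in; case: ifP; case: e. Qed.

Definition reversed (D : raw unit) (T : {fset arrow unit}) : raw unit :=
  exist _ [fset reverse_in T a | a in val D]
    (image_subproof D (endpoint_reverse_in T)).

Definition kauffman_degree_le b (n : nat) (w : gauss b -> rat) : Prop :=
  forall (D : raw unit) (S : {fset arrow unit}),
    S `<=` val D -> (n < #|` S|)%N ->
    \sum_(T <- fpowerset S) (-1) ^+ #|` T| * w (cls b (reversed D T)) = 0.

Definition kauffman_finite_type b (w : gauss b -> rat) : Prop :=
  exists n, kauffman_degree_le n w.

(* [Some n] is the natural number n, and [None] is infinity. *)
Definition enat : Type := option nat.

Definition esucc : enat -> enat := omap succn.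

Definition ele (x y : enat) : bool :=
  match x, y with
  | _, None => true
  | None, Some _ => false
  | Some i, Some j => (i <= j)%N
  end.

Definition elt (x y : enat) : bool := ~~ ele y x.

(* {1, ..., m+1}, resp. {1, 2, ...} and infinity. *)
Definition label (m : enat) : Type :=
  {l : enat | elt (Some 0%N) l && ele l (esucc m)}.

(* [i] is a stage, 1 <= i <= m, with [a] not in C(f^i(D)). *)
Definition dead (m : enat) (D : raw unit) (a : arrow unit) (i : nat) : bool :=
  [&& (0 < i)%N, ele (Some i) m & a \notin val (iter i (@drop_odd _) D)].

Definition flabel_val m D a : enat :=
  match pselect (exists i, dead m D a i) with
  | left ex_dead => Some (ex_minn ex_dead)
  | right _ => esucc m
  end.

Lemma flabel_subproof m D a :
  elt (Some 0%N) (flabel_val m D a) && ele (flabel_val m D a) (esucc m).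
Proof.
rewrite /flabel_val; case: pselect => [ex|_]; last by case: m => //= n; rewrite /elt /=.
case: ex_minnP => i /and3P[i_gt0 le_im _] _.
by rewrite /elt /= -ltnNge i_gt0; case: m le_im {ex} => //= n; exact: leqW.
Qed.

Definition flabel m D a : label m := @exist _ _ (flabel_val m D a) (flabel_subproof m D a).

Definition label_arrow m (D : raw unit) (a : arrow unit) : arrow (label m) :=
  (tail_of a, head_of a, sign_of a, flabel m D a).

Lemma endpoint_label_arrow m D a e :
  endpoint (label_arrow m D a) e = endpoint a (false (+) e).
Proof. by case: e. Qed.

Definition Lambda_raw m (D : raw unit) : raw (label m) :=
  exist _ [fset label_arrow m D a | a in val D]
    (image_subproof D (endpoint_label_arrow m D)).

Definition sdiagram b (m : enat) : Type := diagram (label m) b.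

Definition Lambda b m (D : gauss b) : sdiagram b m :=
  cls b (Lambda_raw m (repr D)).

(* Z[A], the free abelian group on the set A of signed arrow diagrams. *)
Definition chains b m : zmodType := {freeg (sdiagram b m)}.

Definition gen b m (D : raw (label m)) : chains b m := << cls b D >>.

Definition subdiagram_sum b m (D : sdiagram b m) : chains b m :=
  \sum_(F <- fpowerset (val (repr D))) gen b (subdiagram (repr D) F).

Definition pairing b m (x y : chains b m) : int :=
  \sum_(D <- dom x) coeff D x * coeff D y.

Definition Q3_labels m (i j k : label m) : Prop :=
  [\/ elt (val j) (val i) /\ j = k, elt (val i) (val j) /\ i = k,
      elt (val i) (val k) /\ i = j
    | [/\ val i = esucc m, val j = esucc m & val k = esucc m]].

Inductive relator b m (t : nat) : chains b m -> Prop :=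
| Q1 (D : raw (label m)) a of
    a \in val D & isolated b D a & val (label_of a) = esucc m :
    relator t (gen b D)
| Q2 (D : raw (label m)) a a' of omega2 b D a a' & label_of a = label_of a' :
    relator t (gen b D + gen b (delete D a) + gen b (delete D a'))
| Q3 (D D' : raw (label m)) a a' a'' of
    omega3 b D D' a a' a'' & Q3_labels (label_of a) (label_of a') (label_of a'') :
    let mv := move_arrow (exchange a a' a'') in
    relator t
      ((gen b D + gen b (delete D a) + gen b (delete D a')
         + gen b (delete D a''))
       - (gen b D' + gen b (delete D' (mv a)) + gen b (delete D' (mv a'))
         + gen b (delete D' (mv a''))))
| Truncation (D : raw (label m)) of (t < #|` val D|)%N :
    relator t (gen b D).

Inductive generated (V : zmodType) (R : V -> Prop) : V -> Prop :=
| generated_in x of R x : generated R x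
| generated0 : generated R 0
| generatedB x y of generated R x & generated R y : generated R (x - y).

Definition relations b m t : {pred chains b m} :=
  fun x => `[< generated (@relator b m t) x >].
Arguments relations : clear implicits.

Lemma relations_zmod_closed b m t : zmod_closed (relations b m t).
Proof.
split=> [|x y /asboolP hx /asboolP hy]; apply/asboolP; first exact: generated0.
exact: generatedB.
Qed.

HB.instance Definition _ b m t :=
  GRing.isZmodClosed.Build (chains b m) (relations b m t)
    (relations_zmod_closed b m t).

(* The group X_t[m] of the lattice. *)
Definition lattice_group b (m : enat) (t : nat) : zmodType :=
  Quotient.quot (relations b m t).

(* Elements v of Hom(X_t[m], Q), i.e. [{additive lattice_group b m t -> rat}],
   are regarded as the maps [v \o proj t] on Z[A]. *)
Definition proj b m t (x : chains b m) : lattice_group b m t :=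
  \pi_(Quotient.quot (relations b m t)) x.

Definition theta b m (k : nat) (D : sdiagram b m) : int :=
  let C e := [fset a in val (repr D) | (sign_of a == e) && (val (label_of a) == Some k)] in
  #|` C true|%:Z - #|` C false|%:Z.

Definition theta_prod b m s (k t : 'I_s -> nat) (D : sdiagram b m) : int :=
  \prod_(j < s) theta (k j) D ^+ t j.

(* v o I[m] o Lambda[m] *)
Definition lattice_map b m t (v : {additive lattice_group b m t -> rat}) (D : gauss b) : rat :=
  v (proj t (subdiagram_sum (Lambda m D))).

(* The functions represented by the t-th column of the lattice.  Leaving out
   m = 0 only makes the claim that they span an infinite dimensional space
   stronger. *)
Definition column b (t : nat) (w : gauss b -> rat) : Prop :=
  exists m : enat, m <> Some 0%N /\
    exists v : {additive lattice_group b m t -> rat}, w =1 lattice_map v.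

Definition rat_span (T : Type) (U : (T -> rat) -> Prop) (w : T -> rat) : Prop :=
  exists (n : nat) (e : 'I_n -> T -> rat) (c : 'I_n -> rat),
    (forall i, U (e i)) /\ forall x, w x = \sum_(i < n) c i * e i x.

(* No finite family spans the subspace W. *)
Definition infinite_dimensional (T : Type) (W : (T -> rat) -> Prop) : Prop :=
  forall (n : nat) (e : 'I_n -> T -> rat), (forall i, W (e i)) ->
    exists2 w, W w & ~ exists c : 'I_n -> rat,
                         forall x, w x = \sum_(i < n) c i * e i x.

(* Main.v *)
Require Import Defs.
From HB Require Import structures.
From mathcomp Require Import all_boot all_order all_algebra finmap boolp.
From mathcomp Require Import freeg zify ring.

Set Implicit Arguments.
Unset Strict Implicit.
Unset Printing Implicit Defensive.

Import GRing.Theory Num.Theory.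
Local Open Scope fset_scope.
Local Open Scope quotient_scope.
Local Open Scope ring_scope.

(** The product of the [theta (k j) ^+ t j] is a polynomial of degree at most
    [N = \sum_j t j] in the vector of signed arrow counts, and this vector is a sum
    of one weight per arrow. Let [c] be the Moebius inverse of this function on
    the lattice of subsets of arrows, so that its value on a diagram is the sum
    of [c] over all subdiagrams ([sum_mobius]). Since [c E] only depends on the
    signs and labels of the arrows of [E], it is a function on diagrams, and it
    is an iterated finite difference of the polynomial, with one difference for
    each arrow ([mobiusU1]). Hence it vanishes on diagrams with more than [N]
    arrows ([mobius_degree]) and on diagrams with an arrow whose label is not one
    of the [k j] ([mobius_weight0]). Only finitely many diagrams remain
    ([mem_bounded_diagrams]), and [theta_formula] is their combination with
    coefficients [c]. Its pairing kills the relators: Q1 because the label [m+1]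
    is none of the [k j], Q2 because opposite weights make a second difference
    telescope ([mobius_opposite]), Q3 because [c] does not see positions, and the
    truncation because of the degree.

    The functions represented by the lattice are invariant because the sum of
    all labelled subdiagrams is, modulo the relations, unchanged by Reidemeister
    moves: grouping the subdiagrams by what they contain outside the arrows of
    the move leaves exactly the relators ([set_sum_isolated], [set_sum_omega2],
    [set_sum_omega3]). The labels satisfy the hypotheses of the relations by
    parity: an isolated arrow is linked with nothing and never dies, the two
    arrows of the second move are linked with the same arrows, and in the third
    move the parities of the three arrows add up to zero ([odd_in_triple]), so
    that they survive a stage together or exactly two of them die
    ([omega3_labels]). Because a crossing change preserves linking, it preserves
    all labels; as diagrams with more than [t] arrows are zero, each remaining
    subdiagram misses one of any [t+1] crossings, and the alternating sum over
    crossing changes cancels ([alternating_reversed]). In particular the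
    invariance of the products of the [theta (k j)] follows from the formula.

    For the dimension, consider a chain of [2n] arrows, all signed plus, each
    linked with its neighbours only. The two ends are odd and all others are
    even, so each stage cuts off both ends and the labels are 1, ..., [n]
    ([stage_chain]). Thus the [t]-th power of [theta k] vanishes on the chain for
    [k > n] but not for [k = n], and the matrix of values of these powers on the
    chains is triangular with nonzero diagonal of arbitrary size, which is
    impossible inside a finite dimensional space. *)

(** * Sums over all subsets *)

Lemma sum_imfset (I J : choiceType) (V : zmodType) (g : I -> J) (A : {fset I}) (h : J -> V) :
  {in A &, injective g} -> \sum_(y <- g @` A) h y = \sum_(x <- A) h (g x).
Proof. by move=> inj; rewrite big_imfset. Qed.

Lemma card_fset_sum (T : choiceType) (A : {fset T}) (P : pred T) :
  (#|` [fset x in A | P x]| = \sum_(x <- A) P x)%N.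
Proof.
rewrite cardfE -sum1_card -(big_seq_fsetE _ _ predT (fun=> 1%N)) /= big_fset /= big_mkcond /=.
by apply: eq_bigr => x _; case: (P x).
Qed.

Section SubsetSums.
Variables (T : choiceType) (V : zmodType).
Implicit Types (A F : {fset T}) (h : {fset T} -> V).

Lemma sum_fpowersetU1 A x h : x \notin A ->
  \sum_(F <- fpowerset (x |` A)) h F =
  \sum_(F <- fpowerset A) (h F + h (x |` F)).
Proof.
move=> xA; rewrite (big_fsetID _ (fun F : {fset T} => x \notin F)) /= big_split /=.
congr (_ + _).
  apply: eq_fbigl => F; rewrite !inE /= !fpowersetE; apply/andP/idP => [[]|FA].
    move=> /fsubsetP FA xF; apply/fsubsetP => y yF.
    by case/fset1UP: (FA y yF) => // eyx; rewrite -eyx yF in xF.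
  split; first exact: fsubset_trans FA (fsubsetU1 _ _).
  by apply: contra xA => /(fsubsetP FA).
have inj : {in fpowerset A &, injective (fun F => x |` F)}.
  move=> F G; rewrite !fpowersetE => FA GA e.
  have xF : x \notin F by apply: contra xA => /(fsubsetP FA).
  have xG : x \notin G by apply: contra xA => /(fsubsetP GA).
  by rewrite -(fsetU1K xF) -(fsetU1K xG) e.
rewrite -(sum_imfset _ inj); apply: eq_fbigl => F; rewrite !inE /= fpowersetE.
rewrite negbK; apply/andP/imfsetP => /= [[FA xF]|[G GA ->]].
  exists (F `\ x); last by rewrite fsetD1K.
  by rewrite fpowersetE fsubDset.
by rewrite fpowersetE in GA; rewrite fset1U1 fsetUS.
Qed.

Lemma sum_fpowersetD1 A x h : x \in A ->
  \sum_(F <- fpowerset A) h F =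
  \sum_(F <- fpowerset (A `\ x)) (h F + h (x |` F)).
Proof. by move=> xA; rewrite -{1}(fsetD1K xA) sum_fpowersetU1 // fsetD11. Qed.

Lemma sum_fpowersetD2 A x y h : x \in A -> y \in A -> x != y ->
  \sum_(F <- fpowerset A) h F - \sum_(F <- fpowerset ((A `\ x) `\ y)) h F =
  \sum_(F <- fpowerset ((A `\ x) `\ y)) (h (x |` (y |` F)) + h (y |` F) + h (x |` F)).
Proof.
move=> xA yA xy; have yA' : y \in A `\ x by rewrite !inE eq_sym xy.
rewrite (sum_fpowersetD1 _ xA) (sum_fpowersetD1 _ yA') -sumrB.
by apply: eq_bigr => F _; rewrite addrAC [h F + _]addrC addrK addrA [RHS]addrC addrA [RHS]addrAC.
Qed.

Lemma sum_fpowersetD3 A x y z h :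
    x \in A -> y \in A -> z \in A -> x != y -> x != z -> y != z ->
  \sum_(F <- fpowerset A) h F =
  \sum_(F <- fpowerset (((A `\ x) `\ y) `\ z))
     ((h (x |` (y |` (z |` F))) + h (y |` (z |` F)) + h (x |` (z |` F)) + h (x |` (y |` F)))
      + (h (x |` F) + h (y |` F) + h (z |` F) + h F)).
Proof.
move=> xA yA zA xy xz yz; have yA' : y \in A `\ x by rewrite !inE eq_sym xy.
have zA' : z \in (A `\ x) `\ y by rewrite !inE eq_sym yz eq_sym xz.
rewrite (sum_fpowersetD1 _ xA) (sum_fpowersetD1 _ yA') (sum_fpowersetD1 _ zA').
apply: eq_bigr => F _.
by rewrite (AC ((2*2)*(2*2)) ((8*7*6*4)*(2*3*5*1))).
Qed.

(** This compares two sums whose index sets have the same rest outside two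
    triples; the subsets with at most one element of a triple cancel. *)
Lemma sum_fpowersetB3 A A' x y z x' y' z' h :
    [/\ x \in A, y \in A & z \in A] -> [/\ x != y, x != z & y != z] ->
    [/\ x' \in A', y' \in A' & z' \in A'] -> [/\ x' != y', x' != z' & y' != z'] ->
    A `\ x `\ y `\ z = A' `\ x' `\ y' `\ z' ->
    (forall F, F `<=` A `\ x `\ y `\ z ->
       [/\ h (x' |` F) = h (x |` F), h (y' |` F) = h (y |` F) & h (z' |` F) = h (z |` F)]) ->
  \sum_(F <- fpowerset A) h F - \sum_(F <- fpowerset A') h F =
  \sum_(F <- fpowerset (A `\ x `\ y `\ z))
     ((h (x |` (y |` (z |` F))) + h (y |` (z |` F)) + h (x |` (z |` F)) + h (x |` (y |` F)))
      - (h (x' |` (y' |` (z' |` F))) + h (y' |` (z' |` F)) + h (x' |` (z' |` F))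
         + h (x' |` (y' |` F)))).
Proof.
move=> [xA yA zA] [xy xz yz] [x'A y'A z'A] [xy' xz' yz'] eA one.
rewrite (sum_fpowersetD3 _ xA yA zA xy xz yz) (sum_fpowersetD3 _ x'A y'A z'A xy' xz' yz').
rewrite -eA -sumrB big_seq [RHS]big_seq; apply: eq_bigr => F; rewrite fpowersetE => /one[-> -> ->].
by rewrite opprD addrACA subrr addr0.
Qed.

Lemma fsetU1D1 A x y : y \notin A -> x != y -> (x |` (y |` A)) `\ y = x |` A.
Proof.
move=> yA xy; apply/fsetP => z; rewrite !inE.
by case: (eqVneq z y) => [->|] //=; rewrite eq_sym (negPf xy) (negPf yA).
Qed.

Lemma sum_fpowerset_imfset (T' : choiceType) (g : T -> T') (A : {fset T})
    (k : {fset T'} -> V) : {in A &, injective g} ->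
  \sum_(F <- fpowerset (g @` A)) k F = \sum_(F <- fpowerset A) k (g @` F).
Proof.
move=> inj.
rewrite -(@sum_imfset _ _ _ (fun F : {fset T} => g @` F)).
  apply: eq_fbigl => F; rewrite fpowersetE; apply/idP/imfsetP => /= [FA|[G]]; last first.
    rewrite fpowersetE => GA ->; apply/fsubsetP => _ /imfsetP[x /= xG ->].
    by apply/imfsetP; exists x => //=; apply: (fsubsetP GA).
  exists [fset x in A | g x \in F]; first by rewrite fpowersetE; exact: fset_sub.
  apply/fsetP => y; apply/idP/imfsetP => /= [yF|[x]]; last by rewrite !inE /= => /andP[_ xF] ->.
  by have /imfsetP[x /= xA e] := fsubsetP FA y yF; exists x; rewrite ?inE /= ?xA -?e.
move=> F G; rewrite !fpowersetE => FA GA e; apply/fsetP => x.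
apply/idP/idP => [xF|xG].
  have : g x \in g @` G by rewrite -e; apply/imfsetP; exists x.
  by case/imfsetP => /= y yG /inj -> //; [exact: (fsubsetP FA)|exact: (fsubsetP GA)].
have : g x \in g @` F by rewrite e; apply/imfsetP; exists x.
by case/imfsetP => /= y yF /inj -> //; [exact: (fsubsetP GA)|exact: (fsubsetP FA)].
Qed.

End SubsetSums.

(** * Finite differences on the lattice of subsets *)

Section Mobius.
Variables (T : choiceType) (V : zmodType).
Implicit Types (A F : {fset T}) (W : T -> V) (p q : V -> int).

Definition weight_sum W A : V := \sum_(x <- A) W x.

(** The Moebius inverse, on the lattice of subsets, of [fun A => p (weight_sum W A)]. *)
Definition mobius W p A : int :=
  \sum_(F <- fpowerset A) (-1) ^+ (#|` A| + #|` F|) * p (weight_sum W F).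

Definition difference (u : V) p : V -> int := fun x => p (x + u) - p x.

Lemma weight_sumU1 W A x : x \notin A -> weight_sum W (x |` A) = W x + weight_sum W A.
Proof. by move=> xA; rewrite /weight_sum big_fsetU1. Qed.

Lemma weight_sum_imfset (T' : choiceType) (W' : T' -> V) (g : T -> T') W A :
  {in A &, injective g} -> {in A, forall x, W' (g x) = W x} ->
  \sum_(y <- g @` A) W' y = weight_sum W A.
Proof.
by move=> inj e; rewrite sum_imfset // big_seq [RHS]big_seq; apply: eq_bigr.
Qed.

Lemma eq_mobius W p q A : p =1 q -> mobius W p A = mobius W q A.
Proof. by move=> e; apply: eq_bigr => F _; rewrite e. Qed.

Lemma mobiusD W p q A : mobius W (fun x => p x + q x) A = mobius W p A + mobius W q A.
Proof. by rewrite -big_split; apply: eq_bigr => F _; rewrite mulrDr. Qed.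

Lemma mobius_const0 W A : mobius W (fun=> 0) A = 0.
Proof. by apply: big1 => F _; rewrite mulr0. Qed.

Lemma mobius0 W p : mobius W p fset0 = p 0.
Proof.
rewrite /mobius fpowerset0 big_seq_fset1 cardfs0 mul1r /weight_sum big_nil //.
Qed.

(** The subsets with and without [x] enter with opposite signs, so that adding
    an element amounts to taking a difference; iterating, [mobius W p A] is an
    iterated difference of [p] at 0. *)
Lemma mobiusU1 W p A x : x \notin A ->
  mobius W p (x |` A) = mobius W (difference (W x) p) A.
Proof.
move=> xA; rewrite /mobius sum_fpowersetU1 // big_seq [RHS]big_seq.
apply: eq_bigr => F; rewrite fpowersetE => FA.
have xF : x \notin F by apply: contra xA => /(fsubsetP FA).
rewrite weight_sumU1 // !cardfsU1 xA xF /difference [W x + _]addrC !add1n addSn addnS addSn !exprS.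
by ring.
Qed.

Lemma sum_mobius W p A : \sum_(F <- fpowerset A) mobius W p F = p (weight_sum W A).
Proof.
elim/finSet_rect: A p => A IH p; case: (fset_0Vmem A) => [->|[x xA]].
  by rewrite fpowerset0 big_seq_fset1 mobius0 /weight_sum big_nil.
have xA' : x \notin A `\ x by rewrite fsetD11.
have IH' := IH _ (fproperD1 xA).
rewrite (sum_fpowersetD1 _ xA) big_split /= IH' -{3}(fsetD1K xA) weight_sumU1 //.
rewrite big_seq; under eq_bigr => F do
  [rewrite fpowersetE => FA; rewrite mobiusU1; last by apply: contra xA' => /(fsubsetP FA)].
by rewrite -big_seq IH' /difference [W x + _]addrC addrC subrK.
Qed.

(** A difference in the direction 0 is zero. *)
Lemma mobius_weight0 W p A x : x \in A -> W x = 0 -> mobius W p A = 0.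
Proof.
move=> xA W0; rewrite -(fsetD1K xA) mobiusU1 ?fsetD11 // W0.
by rewrite -[RHS](mobius_const0 W (A `\ x)); apply: eq_mobius => y; rewrite /difference addr0 subrr.
Qed.

(** If the weights of [x] and [y] are opposite, then adding both to a set does
    not change its total weight, and the second difference telescopes. *)
Lemma mobius_opposite W p A x y : x \in A -> y \in A -> x != y -> W x + W y = 0 ->
  mobius W p A + mobius W p (A `\ x) + mobius W p (A `\ y) = 0.
Proof.
move=> xA yA xy W0; set B := A `\ x `\ y.
have xB : x \notin B by rewrite !in_fsetD1 eqxx andbF.
have yB : y \notin B by rewrite !in_fsetD1 eqxx.
have eAx : A `\ x = y |` B by rewrite fsetD1K // in_fsetD1 eq_sym xy.
have eAy : A `\ y = x |` B.
  apply/fsetP => z; rewrite in_fset1U !in_fsetD1.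
  by case: (eqVneq z x) => [->|_] //=; rewrite xy xA.
have xyB : x \notin y |` B by rewrite in_fset1U negb_or xy.
rewrite -{1}(fsetD1K xA) eAx eAy !mobiusU1 // -!mobiusD -[RHS](mobius_const0 W B).
apply: eq_mobius => z.
rewrite /difference; have -> : z + W y + W x = z by rewrite -addrA [W y + _]addrC W0 addr0.
by ring.
Qed.

Lemma mobius_imfset (g : T -> T) W p A :
  {in A &, injective g} -> {in A, forall x, W (g x) = W x} ->
  mobius W p (g @` A) = mobius W p A.
Proof.
move=> inj e; rewrite /mobius sum_fpowerset_imfset // big_seq [RHS]big_seq.
apply: eq_bigr => F; rewrite fpowersetE => FA.
have sub x : x \in F -> x \in A by exact: (fsubsetP FA).
rewrite !card_in_imfset //; last by move=> x y xF yF; apply: inj; apply: sub.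
rewrite /weight_sum (@weight_sum_imfset _ W g W) // => [x y xF yF|x xF].
  by apply: inj; apply: sub.
exact/e/sub.
Qed.

(** Polynomial functions of degree less than [n], characterized without
    coordinates by their differences. *)
Fixpoint degree_lt n p : Prop :=
  if n is n'.+1 then forall u, degree_lt n' (difference u p) else p =1 fun=> 0.

Lemma eq_degree_lt n p q : p =1 q -> degree_lt n p -> degree_lt n q.
Proof.
elim: n p q => [|n IH] p q e /=; first by move=> p0 x; rewrite -e p0.
by move=> pn u; apply: IH (pn u) => x; rewrite /difference !e.
Qed.

Lemma degree_ltD n p q :
  degree_lt n p -> degree_lt n q -> degree_lt n (fun x => p x + q x).
Proof.
elim: n p q => [|n IH] p q /=; first by move=> p0 q0 x; rewrite p0 q0 addr0.
move=> pn qn u; apply: eq_degree_lt (IH _ _ (pn u) (qn u)) => x.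
by rewrite /difference; ring.
Qed.

Lemma degree_ltZ n (c : int) p : degree_lt n p -> degree_lt n (fun x => p x * c).
Proof.
elim: n p => [|n IH] p /=; first by move=> p0 x; rewrite p0 mul0r.
by move=> pn u; apply: eq_degree_lt (IH _ (pn u)) => x; rewrite /difference mulrBl.
Qed.

Lemma degree_ltS n p : degree_lt n p -> degree_lt n.+1 p.
Proof.
elim: n p => [|n IH] p /= pn; first by move=> u x; rewrite /difference !pn subrr.
by move=> u; exact: IH.
Qed.

(** By the Leibniz rule, because the differences of [l] are constant. *)
Lemma degree_ltM n p (l : {additive V -> int}) :
  degree_lt n p -> degree_lt n.+1 (fun x => p x * l x).
Proof.
elim: n p => [|n IH] p pn.
  by apply: degree_ltS => x /=; rewrite pn mul0r.
move=> u; apply: (@eq_degree_lt _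
    (fun x => difference u p x * l x + (difference u p x * l u + p x * l u))).
  by move=> x; rewrite /difference raddfD; ring.
apply: degree_ltD; first exact: IH (pn u).
apply: degree_ltD; last exact: degree_ltZ.
by apply: degree_ltZ; apply: degree_ltS; exact: pn.
Qed.

Lemma mobius_degree n W p A : degree_lt n p -> (n <= #|` A|)%N -> mobius W p A = 0.
Proof.
elim/finSet_rect: A n p => A IH n p pn nA; case: (fset_0Vmem A) => [A0|[x xA]].
  by move: nA pn; rewrite A0 cardfs0 leqn0 => /eqP -> /= p0; rewrite mobius0 p0.
rewrite -(fsetD1K xA) mobiusU1 ?fsetD11 //.
case: n pn nA => [|n] pn nA.
  rewrite -[RHS](mobius_const0 W (A `\ x)); apply: eq_mobius => y.
  by rewrite /difference !pn subrr.
apply: (IH _ (fproperD1 xA) n) => //.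
by move: nA; rewrite (cardfsD1 x) xA.
Qed.

End Mobius.

(** * Crossing chords and neighbouring endpoints *)

Definition between (u v p : nat) : bool := (minn u v < p < maxn u v)%N.

Definition cross (u v p q : nat) : bool := between u v p (+) between u v q.

Lemma linkedE (L : choiceType) (a a' : arrow L) :
  linked a a' = cross (tail_of a) (head_of a) (tail_of a') (head_of a').
Proof. by []. Qed.

Lemma crossC u v p q : cross u v p q = cross v u p q.
Proof. by rewrite /cross /between minnC maxnC. Qed.

Lemma cross_revr u v p q : cross u v p q = cross u v q p.
Proof. by rewrite /cross addbC. Qed.

(** With this formula statements about crossings become identities modulo 2. *)
Lemma between_addb u v p : u != p -> v != p -> between u v p = (u < p)%N (+) (v < p)%N.
Proof. by rewrite /between; lia. Qed.

Lemma ltn_flip (p q : nat) : p != q -> (q < p)%N = ~~ (p < q)%N.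
Proof. by lia. Qed.

Lemma cross_sym u v p q : u != p -> u != q -> v != p -> v != q ->
  cross u v p q = cross p q u v.
Proof.
move=> up uq vp vq; rewrite /cross !between_addb // 1?eq_sym //.
rewrite (ltn_flip up) (ltn_flip uq) (ltn_flip vp) (ltn_flip vq).
by case: (u < p)%N; case: (u < q)%N; case: (v < p)%N; case: (v < q)%N.
Qed.

(** In the sum of the three formulas, the comparisons with [p] cancel, and each
    of the pairs [qr], [qs], [rs] is compared once in either direction, which
    leaves 1 + 1 + 1. *)
Lemma cross_matchings p q r s :
  p != q -> p != r -> p != s -> q != r -> q != s -> r != s ->
  cross p q r s (+) cross p r q s (+) cross p s q r.
Proof.
move=> pq pr ps qr qs rs; rewrite /cross !between_addb // 1?eq_sym //.
rewrite (ltn_flip qr) (ltn_flip qs) (ltn_flip rs).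
by case: (p < q)%N; case: (p < r)%N; case: (p < s)%N; case: (q < r)%N; case: (q < s)%N;
   case: (r < s)%N.
Qed.

(** On the circle, crossing is a matter of cyclic order only: changing the cut
    point replaces an arc by its complement, for both ends of the other chord. *)
Lemma cross_in_arc u v p q : u != p -> u != q -> v != p -> v != q -> u != v ->
  cross u v p q = in_arc Circle u v p (+) in_arc Circle u v q.
Proof. by rewrite /cross /between /=; lia. Qed.

Section Endpoints.
Variable L : choiceType.
Implicit Types (D : raw L) (a c : arrow L) (A : {fset arrow L}).

Lemma endpoint_in A a e : a \in A -> endpoint a e \in endpoints A.
Proof. by move=> aA; apply/endpointsP; exists a => //; exists e. Qed.

Lemma tail_in A a : a \in A -> tail_of a \in endpoints A.
Proof. exact: (@endpoint_in A a false). Qed.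

Lemma head_in A a : a \in A -> head_of a \in endpoints A.
Proof. exact: (@endpoint_in A a true). Qed.

Lemma endpoints_sub A A' : A `<=` A' -> {subset endpoints A <= endpoints A'}.
Proof.
move=> /fsubsetP sAA' x /endpointsP[a aA [e ->]]; exact: endpoint_in (sAA' a aA).
Qed.

Lemma distinct_sub A A' : A `<=` A' -> distinct_endpoints A' -> distinct_endpoints A.
Proof. by move=> /fsubsetP s d a a' aA a'A; apply: d; apply: s. Qed.

Lemma neq_endpoint A a c e e' : distinct_endpoints A -> a \in A -> c \in A -> a != c ->
  endpoint a e != endpoint c e'.
Proof. by move=> d aA cA; apply: contra => /eqP /(d _ _ aA cA)[-> _]. Qed.

Lemma neq_tail_head A a : distinct_endpoints A -> a \in A -> tail_of a != head_of a.
Proof.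
by move=> d aA; apply/eqP => e; have := d a a aA aA false true e.
Qed.

Lemma linked_sym A a c : distinct_endpoints A -> a \in A -> c \in A ->
  linked a c = linked c a.
Proof.
move=> d aA cA; case: (eqVneq a c) => [->//|ac]; rewrite !linkedE.
have n e e' := neq_endpoint e e' d aA cA ac.
exact: cross_sym (n false false) (n false true) (n true false) (n true true).
Qed.

Lemma linkedxx a : linked a a = false.
Proof. by rewrite linkedE /cross /between; lia. Qed.

Lemma follows_arc b D p q x : follows b D p q -> x \in endpoints (val D) ->
  ~~ in_arc b p q x.
Proof. by move=> /and4P[_ _ _ /hasPn h] /h. Qed.

Lemma follows_in b D p q : follows b D p q ->
  [/\ p \in endpoints (val D), q \in endpoints (val D) & p != q].
Proof. by case/and4P => pE qE pq _; split=> //; case: b pq => //; lia. Qed.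

Lemma adjacent_in b D p q : adjacent b D p q ->
  [/\ p \in endpoints (val D), q \in endpoints (val D) & p != q].
Proof. by case/orP => /follows_in[pE qE pq]; split=> //; rewrite eq_sym. Qed.

(** If [p] and [q] are neighbours across the cut point of the circle, they are
    the extreme endpoints, and no interval between other endpoints contains
    either of them. *)
Lemma adjacent_between b D p q u v : adjacent b D p q ->
  u \in endpoints (val D) -> v \in endpoints (val D) ->
  u != p -> u != q -> v != p -> v != q -> between u v p = between u v q.
Proof.
move=> adj uE vE; rewrite /between.
by case/orP: adj => f; have := follows_arc f uE; have := follows_arc f vE;
   case/and4P: f => _ _ + _; case: b => /= *; lia.
Qed.

Lemma adjacent_lt D p q u : adjacent Line D p q -> u \in endpoints (val D) ->
  u != p -> u != q -> ((p < u) = (q < u))%N * ((u < p) = (u < q))%N.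
Proof.
move=> adj uE up uq.
by case/orP: adj => f; have := follows_arc f uE; case/and4P: f => _ _ /= *; split; lia.
Qed.

Lemma adjacent_in_arc D p q u v : adjacent Circle D p q ->
  u \in endpoints (val D) -> v \in endpoints (val D) ->
  u != p -> u != q -> v != p -> v != q -> in_arc Circle u v p = in_arc Circle u v q.
Proof.
move=> adj uE vE.
by case/orP: adj => f; have := follows_arc f uE; have := follows_arc f vE;
   case/and4P: f => _ _ + _ /= *; lia.
Qed.

End Endpoints.

Lemma follows_sub (L L' : choiceType) b (D : raw L) (D1 : raw L') p q :
  {subset endpoints (val D1) <= endpoints (val D)} ->
  p \in endpoints (val D1) -> q \in endpoints (val D1) ->
  follows b D p q -> follows b D1 p q.
Proof.
move=> s pE qE /and4P[_ _ pq /hasPn h]; apply/and4P; split=> //.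
by apply/hasPn => x /s /h.
Qed.

Lemma adjacent_sub (L L' : choiceType) b (D : raw L) (D1 : raw L') p q :
  {subset endpoints (val D1) <= endpoints (val D)} ->
  p \in endpoints (val D1) -> q \in endpoints (val D1) ->
  adjacent b D p q -> adjacent b D1 p q.
Proof. by move=> s pE qE /orP[] /follows_sub f; apply/orP; [left|right]; exact: f. Qed.

(** * Homeomorphisms *)

Lemma orientation_circle b phi E :
  orientation_preserving b phi E -> orientation_preserving Circle phi E.
Proof.
case: b => //= mono; split; first exact: (orientation_preserving_inj (b := Line)).
by move=> p q x pE qE xE; rewrite !mono.
Qed.

Section Slide.
Variables (L : choiceType) (b : base) (D : raw L) (E : {fset nat}) (phi : nat -> nat).
Hypothesis subE : {subset E <= endpoints (val D)}.
Hypothesis slide : {in E, forall p, phi p = p \/ adjacent b D p (phi p) /\ phi p \notin E}.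
Hypothesis inj_phi : {in E &, injective phi}.

Let phi_in p : p \in E -> phi p \in endpoints (val D).
Proof. by move=> pE; case: (slide pE) => [->|[/adjacent_in[]]//]; exact: subE. Qed.

Let phi_neq p q : p \in E -> q \in E -> p != q -> (q != phi p) * (phi q != phi p).
Proof.
move=> pE qE pq; split; last first.
  by apply: contra pq => /eqP /inj_phi -> //.
case: (slide pE) => [->|[_ npE]]; first by rewrite eq_sym.
by apply: contraNneq npE => <-.
Qed.

(** Moving some points of [E] each to a neighbouring endpoint outside [E] can be
    done one point at a time, and no point ever jumps over another one. *)
Lemma slide_orientation : orientation_preserving b phi E.
Proof.
have sub := subE; have im := phi_in; have ne := phi_neq; have sl := slide.
have eqn p q : p \in E -> q \in E -> p != q ->
    [/\ q != p, q != phi p, phi q != p & phi q != phi p].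
  move=> pE qE pq; split; rewrite ?(ne _ _ pE qE pq) //; first by rewrite eq_sym.
  by rewrite eq_sym; apply: (ne _ _ qE pE _).1; rewrite eq_sym.
case: b sl => sl.
  move=> p q pE qE; case: (eqVneq p q) => [->|pq]; first by rewrite !ltnn.
  have [n1 n2 n3 n4] := eqn p q pE qE pq.
  transitivity (p < phi q)%N.
    case: (sl p pE) => [->//|[adj _]].
    by rewrite (adjacent_lt adj (im q qE) n3 n4).
  case: (sl q qE) => [->//|[adj _]].
  by rewrite (adjacent_lt adj (sub p pE)) // eq_sym.
split=> // p q x pE qE xE.
case: (eqVneq p q) => [->|pq]; first by rewrite /=; lia.
case: (eqVneq q x) => [->|qx]; first by rewrite /=; lia.
case: (eqVneq p x) => [->|px]; first by rewrite /=; lia.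
have arc u v w : u \in endpoints (val D) -> v \in endpoints (val D) -> w \in E ->
    u != w -> u != phi w -> v != w -> v != phi w ->
    in_arc Circle u v (phi w) = in_arc Circle u v w.
  move=> uE vE wE; case: (sl w wE) => [->//|[adj _]] *.
  by rewrite (adjacent_in_arc adj).
have ne' u v : u \in E -> v \in E -> u != v ->
    [/\ u != v, u != phi v, phi u != v & phi u != phi v].
  move=> uE vE uv; have vu : v != u by rewrite eq_sym.
  have [m1 m2 m3 m4] := eqn v u vE uE vu.
  by split=> //; rewrite eq_sym.
have [a1 a2 a3 a4] := ne' _ _ pE qE pq; have [b1 b2 b3 b4] := eqn _ _ pE qE pq.
have [c1 c2 c3 c4] := ne' _ _ pE xE px; have [d1 d2 d3 d4] := ne' _ _ qE xE qx.
have [e1 e2 e3 e4] := eqn _ _ pE xE px; have [f1 f2 f3 f4] := eqn _ _ qE xE qx.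
(* The points are rotated so that each in turn comes last and is slid there. *)
rewrite arc ?im //.
transitivity (in_arc Circle x (phi p) (phi q)); first by rewrite /=; lia.
rewrite arc ?im ?sub //.
transitivity (in_arc Circle q x (phi p)); first by rewrite /=; lia.
by rewrite arc ?sub //=; lia.
Qed.

End Slide.

Section Move.
Variable L : choiceType.
Implicit Types (D : raw L) (a c : arrow L) (A : {fset arrow L}) (phi : nat -> nat).

Lemma arrow_eta a : (tail_of a, head_of a, sign_of a, label_of a) = a.
Proof. by case: a => [[[]]]. Qed.

Lemma move_arrow_inj phi A : distinct_endpoints A ->
  {in endpoints A &, injective phi} -> {in A &, injective (@move_arrow L phi)}.
Proof.
move=> d inj a c aA cA /(congr1 (fun x => endpoint x false)); rewrite !endpoint_move.
by move=> /inj e; have /(d _ _ aA cA)[] := e (endpoint_in _ aA) (endpoint_in _ cA).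
Qed.

Lemma move_arrow_id phi a : phi (tail_of a) = tail_of a -> phi (head_of a) = head_of a ->
  move_arrow phi a = a.
Proof. by move=> e e'; rewrite /move_arrow e e' arrow_eta. Qed.

Lemma distinct_move phi A : distinct_endpoints A ->
  {in endpoints A &, injective phi} -> distinct_endpoints (move_arrow phi @` A).
Proof.
move=> d inj _ _ /imfsetP[a /= aA ->] /imfsetP[c /= cA ->] e e'.
rewrite !endpoint_move => /inj h.
by have /(d _ _ aA cA)[-> ->] := h (endpoint_in _ aA) (endpoint_in _ cA).
Qed.

Lemma orientation_sub b phi (E E' : {fset nat}) : {subset E <= E'} ->
  orientation_preserving b phi E' -> orientation_preserving b phi E.
Proof.
move=> s; case: b => /= [m p q pE qE|[i m]]; first by rewrite m ?s.
by split=> [p q pE qE|p q x pE qE xE]; [apply: i; apply: s | rewrite m ?s].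
Qed.

Lemma distinct_raw A : distinct_endpoints A -> exists D : raw L, val D = A.
Proof. by move=> /asboolP d; exists (exist _ A d). Qed.

Lemma val_delete D a : val (delete D a) = val D `\ a.
Proof. by apply/fsetP => c; rewrite !inE /= andbC. Qed.

Lemma homeomorphic_repr b D : homeomorphic b D (repr (cls b D)).
Proof.
by apply/asboolP/(eqmodP (homeo_equiv_rel L b)); rewrite reprK.
Qed.

Lemma cls_homeomorphic b D D' : homeomorphic b D D' -> cls b D = cls b D'.
Proof. by move=> h; apply/eqmodP/asboolP. Qed.

End Move.

(** * Diagrams as sets of arrows *)

Section Gen.
Variables (b : base) (m : enat).
Notation A_m := (arrow (label m)).
Implicit Types (D : raw (label m)) (A : {fset A_m}).

(** The generator given by a set of arrows, extended by 0 to sets that are not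
    diagrams, so that sums over subsets need no proofs of distinctness. *)
Definition set_gen A : chains b m :=
  oapp (@gen b m) 0 (insub A : option (raw (label m))).

Lemma set_genE D : set_gen (val D) = gen b D.
Proof. by rewrite /set_gen valK. Qed.

Lemma gen_homeomorphic D D' : homeomorphic b D D' -> gen b D = gen b D'.
Proof. by move=> h; rewrite /gen (cls_homeomorphic h). Qed.

Lemma set_gen_move phi A : distinct_endpoints A ->
  orientation_preserving b phi (endpoints A) ->
  set_gen (move_arrow phi @` A) = set_gen A.
Proof.
move=> d h; have d' := distinct_move d (orientation_preserving_inj h).
have [D DA] := distinct_raw d; have [D' D'A] := distinct_raw d'.
rewrite -D'A -DA !set_genE; symmetry; apply: gen_homeomorphic.
by exists phi; rewrite ?D'A DA.
Qed.

Definition set_sum A : chains b m := \sum_(F <- fpowerset A) set_gen F.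

Lemma set_sum_move phi A : distinct_endpoints A ->
  orientation_preserving b phi (endpoints A) ->
  set_sum (move_arrow phi @` A) = set_sum A.
Proof.
move=> d h; rewrite /set_sum sum_fpowerset_imfset; last first.
  exact: move_arrow_inj d (orientation_preserving_inj h).
rewrite big_seq [RHS]big_seq; apply: eq_bigr => F; rewrite fpowersetE => FA.
apply: set_gen_move; first exact: distinct_sub FA d.
exact: orientation_sub (endpoints_sub FA) h.
Qed.

Lemma subdiagram_sum_repr (E : sdiagram b m) : subdiagram_sum E = set_sum (val (repr E)).
Proof.
rewrite /subdiagram_sum /set_sum big_seq [RHS]big_seq; apply: eq_bigr => F.
rewrite fpowersetE => /fsubsetP FA; rewrite -set_genE; congr set_gen.
by apply/fsetP => a; rewrite !inE /=; apply: andb_idl; exact: FA.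
Qed.

Lemma subdiagram_sum_cls D : subdiagram_sum (cls b D) = set_sum (val D).
Proof.
rewrite subdiagram_sum_repr; have [phi h ->] := homeomorphic_repr b D.
by apply: set_sum_move => //; exact: rawP.
Qed.

(** * The relations, read on sets of arrows *)

Section Relations.
Variable t : nat.
Notation rel := (relations b m t).

Lemma relator_rel x : relator t x -> x \in rel.
Proof. by move=> r; apply/asboolP; apply: generated_in. Qed.

Lemma isolated_sub D D1 a : val D1 `<=` val D -> a \in val D1 ->
  isolated b D a -> isolated b D1 a.
Proof.
move=> s aD1; apply: adjacent_sub; first exact: endpoints_sub.
  exact: tail_in.
exact: head_in.
Qed.

(** An isolated arrow labelled [m+1] is isolated in every subdiagram that
    contains it, so all the new subdiagrams vanish by Q1. *)
Lemma set_sum_isolated D a : a \in val D -> isolated b D a -> val (label_of a) = esucc m ->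
  set_sum (val D) - set_sum (val D `\ a) \in rel.
Proof.
move=> aD iso lab; rewrite /set_sum (sum_fpowersetD1 _ aD) big_split /= addrAC subrr add0r.
rewrite big_seq; apply: rpred_sum => F; rewrite fpowersetE fsubsetD1 => /andP[FD aF].
have sub : a |` F `<=` val D by rewrite fsubUset fsub1set aD.
have [E EA] := distinct_raw (distinct_sub sub (rawP (D := D))).
have aE : a \in val E by rewrite EA fset1U1.
rewrite -EA set_genE; apply: relator_rel; apply: (Q1 _ aE) lab.
by apply: isolated_sub aE iso; rewrite EA.
Qed.

Lemma omega2_neq D a a' : omega2 b D a a' -> a != a'.
Proof. by case=> _ _ + _ _; apply: contra => /eqP ->. Qed.

(** The subdiagrams that contain [a] or [a'] fall into triples with the same
    other arrows, and each triple is a relator of type Q2. *)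
Lemma set_sum_omega2 D a a' : omega2 b D a a' -> label_of a = label_of a' ->
  set_sum (val D) - set_sum ((val D `\ a) `\ a') \in rel.
Proof.
move=> o2 lab; have neq := omega2_neq o2; case: (o2) => aD a'D sgn adjt adjh.
rewrite /set_sum (sum_fpowersetD2 _ aD a'D neq) big_seq; apply: rpred_sum => F.
rewrite fpowersetE !fsubsetD1 => /andP[/andP[FD aF] a'F].
have aF' : a \notin a' |` F by rewrite !inE negb_or neq.
have sub : a |` (a' |` F) `<=` val D by rewrite !fsubUset !fsub1set aD a'D.
have [E EA] := distinct_raw (distinct_sub sub (rawP (D := D))).
have subE : {subset endpoints (val E) <= endpoints (val D)}.
  by apply: endpoints_sub; rewrite EA.
have aE : a \in val E by rewrite EA !inE eqxx.
have a'E : a' \in val E by rewrite EA !inE eqxx orbT.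
have dela : val (delete E a) = a' |` F by rewrite val_delete EA (fsetU1K aF').
have dela' : val (delete E a') = a |` F by rewrite val_delete EA; exact: fsetU1D1.
rewrite -EA -dela -dela' !set_genE; apply: relator_rel.
apply: Q2 lab; split=> //.
  by apply: adjacent_sub subE _ _ adjt; exact: tail_in.
by apply: adjacent_sub subE _ _ adjh; exact: head_in.
Qed.

End Relations.
End Gen.

(** * The third Reidemeister move *)

Section Omega3.
Variables (L : choiceType) (b : base) (D D' : raw L) (a a' a'' : arrow L).
Hypothesis o3 : omega3 b D D' a a' a''.

Let ex := exchange a a' a''.
Let mv : arrow L -> arrow L := move_arrow ex.
Let dD := rawP (D := D).
Let dD' := rawP (D := D').

Lemma omega3_in : [/\ a \in val D, a' \in val D & a'' \in val D].
Proof. by case: o3. Qed.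

Lemma omega3_val : val D' = mv @` val D.
Proof. by case: o3. Qed.

Lemma omega3_follows : [/\ follows b D (tail_of a) (tail_of a'),
  follows b D (head_of a) (tail_of a'') & follows b D (head_of a') (head_of a'')].
Proof. by case: o3. Qed.

(** If the first and the third arrow coincided, the exchange would identify two
    endpoints, and the result would not be a diagram. *)
Lemma omega3_neq : [/\ a != a', a != a'' & a' != a''].
Proof.
have [aD a'D a''D] := omega3_in; have [f1 f2 f3] := omega3_follows.
have [_ _ n1] := follows_in f1; have [_ _ n2] := follows_in f2; have [_ _ n3] := follows_in f3.
have n : a != a' by apply: contraNneq n1 => ->.
have n' : a' != a'' by apply: contraNneq n3 => ->.
split=> //; apply/eqP => e.
have mvD' c : c \in val D -> mv c \in val D'.
  by move=> cD; rewrite omega3_val; apply/imfsetP; exists c.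
have h1 : endpoint (mv a) true = tail_of a.
  rewrite endpoint_move /ex /exchange /= -e eqxx eq_sym (negPf (neq_tail_head dD aD)).
  by rewrite (negPf (neq_endpoint true false dD aD a'D n)).
have h2 : endpoint (mv a') false = tail_of a.
  by rewrite endpoint_move /ex /exchange /= eq_sym (negPf n1) eqxx.
have := dD' (mvD' _ aD) (mvD' _ a'D) (e := true) (e' := false).
by rewrite h1 h2 => /(_ erefl) [].
Qed.

Lemma omega3_uniq : uniq [:: tail_of a; tail_of a'; head_of a; tail_of a''; head_of a'; head_of a''].
Proof.
have [aD a'D a''D] := omega3_in; have [n1 n2 n3] := omega3_neq.
have ne c c' e e' cD c'D n := negPf (@neq_endpoint _ _ c c' e e' dD cD c'D n).
have th c cD := negPf (@neq_tail_head _ _ c dD cD).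
rewrite /= !inE (ne _ _ false false aD a'D n1) (th a aD) (ne _ _ false false aD a''D n2).
rewrite (ne _ _ false true aD a'D n1) (ne _ _ false true aD a''D n2).
rewrite [tail_of a' == _]eq_sym (ne _ _ true false aD a'D n1).
rewrite (ne _ _ false false a'D a''D n3) (th a' a'D) (ne _ _ false true a'D a''D n3).
rewrite (ne _ _ true false aD a''D n2) (ne _ _ true true aD a'D n1) (ne _ _ true true aD a''D n2).
rewrite [tail_of a'' == _]eq_sym (ne _ _ true false a'D a''D n3) (th a'' a''D).
by rewrite (ne _ _ true true a'D a''D n3).
Qed.

Lemma exchange_triple :
  [/\ ex (tail_of a) = tail_of a', ex (tail_of a') = tail_of a,
      ex (head_of a) = tail_of a'' & ex (tail_of a'') = head_of a] /\
  ex (head_of a') = head_of a'' /\ ex (head_of a'') = head_of a'.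
Proof.
have := omega3_uniq; rewrite /= !inE !negb_or.
move=> /and5P[/and5P[n12 n13 n14 n15 n16] /and4P[n23 n24 n25 n26] /and3P[n34 n35 n36]].
move=> /andP[n45 n46] /andP[n56 _].
by rewrite /ex /exchange /=; do !split; rewrite ?eqxx //;
  rewrite ![_ == tail_of a]eq_sym ?(negPf n12) ?(negPf n13) ?(negPf n14) ?(negPf n15) ?(negPf n16)
    ?eqxx //;
  rewrite ![_ == tail_of a']eq_sym ?(negPf n23) ?(negPf n24) ?(negPf n25) ?(negPf n26) ?eqxx //;
  rewrite ![_ == head_of a]eq_sym ?(negPf n34) ?(negPf n35) ?(negPf n36) ?eqxx //;
  rewrite ![_ == tail_of a'']eq_sym ?(negPf n45) ?(negPf n46) ?eqxx //;
  rewrite [_ == head_of a']eq_sym (negPf n56).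
Qed.

Definition in_triple c := [|| c == a, c == a' | c == a''].

Lemma exchange_fix c e : c \in val D -> ~~ in_triple c -> ex (endpoint c e) = endpoint c e.
Proof.
have [aD a'D a''D] := omega3_in.
rewrite /in_triple !negb_or => cD /and3P[n1 n2 n3].
rewrite /ex /exchange /=.
by rewrite (negPf (neq_endpoint e false dD cD aD n1)) (negPf (neq_endpoint e true dD cD aD n1))
   (negPf (neq_endpoint e false dD cD a'D n2)) (negPf (neq_endpoint e true dD cD a'D n2))
   (negPf (neq_endpoint e false dD cD a''D n3)) (negPf (neq_endpoint e true dD cD a''D n3)).
Qed.

Lemma move_fix c : c \in val D -> ~~ in_triple c -> mv c = c.
Proof.
move=> cD nc; apply: move_arrow_id; first exact: (exchange_fix false cD nc).
exact: (exchange_fix true cD nc).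
Qed.

(** This makes the exchange a sliding to neighbouring places, and it names the
    arrow whose removal frees the new place. *)
Lemma exchange_partner c e : c \in val D -> in_triple c ->
  exists c' e', [/\ c' \in val D, c' != c, in_triple c', ex (endpoint c e) = endpoint c' e' &
    adjacent b D (endpoint c e) (ex (endpoint c e))].
Proof.
have [aD a'D a''D] := omega3_in; have [n1 n2 n3] := omega3_neq.
have [[e1 e2 e3 e4] [e5 e6]] := exchange_triple; have [f1 f2 f3] := omega3_follows.
rewrite /in_triple => cD /or3P[] /eqP ec; subst c; case: e => /=.
- by exists a'', false; rewrite e3 eqxx !orbT eq_sym n2 /adjacent f2.
- by exists a', false; rewrite e1 eqxx !orbT eq_sym n1 /adjacent f1.
- by exists a'', true; rewrite e5 eqxx !orbT eq_sym n3 /adjacent f3.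
- by exists a, false; rewrite e2 eqxx n1 /adjacent f1 orbT.
- by exists a', true; rewrite e6 eqxx !orbT n3 /adjacent f3 orbT.
- by exists a, true; rewrite e4 eqxx n2 /adjacent f2 orbT.
Qed.

Lemma exchangeK : {in endpoints (val D), involutive ex}.
Proof.
have [[e1 e2 e3 e4] [e5 e6]] := exchange_triple.
move=> _ /endpointsP[c cD [e ->]]; case: (boolP (in_triple c)) => [|nc]; last first.
  by rewrite !exchange_fix.
by case/or3P => /eqP ->; case: e => /=; rewrite ?e1 ?e2 ?e3 ?e4 ?e5 ?e6.
Qed.

Lemma exchange_inj : {in endpoints (val D) &, injective ex}.
Proof. by move=> p q pE qE e; rewrite -(exchangeK pE) -(exchangeK qE) e. Qed.

Lemma move_exchange_inj : {in val D &, injective mv}.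
Proof. exact: move_arrow_inj dD exchange_inj. Qed.

(** Once two of the three arrows are gone, the exchange only moves endpoints to
    places that have become free: the two sides are homeomorphic. *)
Lemma exchange_orientation (A : {fset arrow L}) : A `<=` val D ->
  (forall c c', c \in A -> c' \in A -> in_triple c -> in_triple c' -> c = c') ->
  orientation_preserving b ex (endpoints A).
Proof.
move=> AD one; have sub := endpoints_sub AD; apply: (slide_orientation (D := D)) => //.
  move=> _ /endpointsP[c cA [e ->]]; have cD := fsubsetP AD c cA.
  case: (boolP (in_triple c)) => [tc|nc]; last by left; rewrite exchange_fix.
  right; have [c' [e' [c'D nc' tc' ec' adj]]] := exchange_partner e cD tc; split=> //.
  rewrite ec'; apply/endpointsP => -[c1 c1A [e1 ee1]]; have c1D := fsubsetP AD c1 c1A.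
  have [e2 _] := dD c'D c1D ee1.
  by move: nc'; rewrite (one _ _ cA c1A tc) -?e2 ?eqxx.
by move=> p q /sub pE /sub qE; exact: exchange_inj.
Qed.

End Omega3.

Lemma fsetD3P (T : choiceType) (A : {fset T}) (x y z c : T) :
  reflect [/\ c != x, c != y, c != z & c \in A] (c \in A `\ x `\ y `\ z).
Proof.
rewrite !in_fsetD1; apply: (iffP and4P) => [[n3 n2 n1 cA]|[n1 n2 n3 cA]]; by split.
Qed.

Section Omega3Sub.
Variables (L : choiceType) (b : base) (D D' : raw L) (a a' a'' : arrow L).
Hypothesis o3 : omega3 b D D' a a' a''.
Notation mv := (move_arrow (exchange a a' a'')).

Lemma omega3_sub E E' : val E `<=` val D -> a \in val E -> a' \in val E -> a'' \in val E ->
  val E' = mv @` val E -> omega3 b E E' a a' a''.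
Proof.
move=> sub aE a'E a''E e; have s := endpoints_sub sub.
case: o3 => _ sg [f1 f2 f3] _; split=> //; split.
- by apply: follows_sub s _ _ f1; exact: tail_in.
- by apply: follows_sub s _ _ f2; [exact: head_in|exact: tail_in].
- by apply: follows_sub s _ _ f3; exact: head_in.
Qed.

Lemma omega3_rest : val D `\ a `\ a' `\ a'' = val D' `\ mv a `\ mv a' `\ mv a''.
Proof.
have [aD a'D a''D] := omega3_in o3; have inj := move_exchange_inj o3.
have fix_ c : c \in val D `\ a `\ a' `\ a'' -> c \in val D /\ mv c = c.
  case/fsetD3P => n1 n2 n3 cD; split=> //; apply: (move_fix o3) => //.
  by rewrite /in_triple !negb_or n1 n2 n3.
apply/fsetP => c; apply/idP/idP => [cR|].
  have [cD ec] := fix_ c cR; case/fsetD3P: cR => n1 n2 n3 _; apply/fsetD3P; split.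
  - by apply: contra n1; rewrite -{1}ec => /eqP /inj ->.
  - by apply: contra n2; rewrite -{1}ec => /eqP /inj ->.
  - by apply: contra n3; rewrite -{1}ec => /eqP /inj ->.
  - by rewrite (omega3_val o3) -ec; apply/imfsetP; exists c.
case/fsetD3P => n1 n2 n3; rewrite (omega3_val o3) => /imfsetP[d /= dD ed].
have dR : d \in val D `\ a `\ a' `\ a''.
  apply/fsetD3P; split=> //.
  - by apply: contra n1 => /eqP e; rewrite ed e.
  - by apply: contra n2 => /eqP e; rewrite ed e.
  - by apply: contra n3 => /eqP e; rewrite ed e.
by rewrite ed (fix_ d dR).2.
Qed.

End Omega3Sub.

Section SetSumOmega3.
Variables (b : base) (m : enat) (t : nat) (D D' : raw (label m)) (a a' a'' : arrow (label m)).
Hypothesis o3 : omega3 b D D' a a' a''.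
Hypothesis q3 : Q3_labels (label_of a) (label_of a') (label_of a'').
Notation mv := (move_arrow (exchange a a' a'')).
Notation g := (@set_gen b m).

Let aD : a \in val D. Proof. by case: (omega3_in o3). Qed.
Let a'D : a' \in val D. Proof. by case: (omega3_in o3). Qed.
Let a''D : a'' \in val D. Proof. by case: (omega3_in o3). Qed.
Let n1 : a != a'. Proof. by case: (omega3_neq o3). Qed.
Let n2 : a != a''. Proof. by case: (omega3_neq o3). Qed.
Let n3 : a' != a''. Proof. by case: (omega3_neq o3). Qed.

Let mvD' c : c \in val D -> mv c \in val D'.
Proof. by move=> cD; rewrite (omega3_val o3); apply/imfsetP; exists c. Qed.

Let mv_neq c c' : c \in val D -> c' \in val D -> c != c' -> mv c != mv c'.
Proof. by move=> cD c'D; apply: contra => /eqP /(move_exchange_inj o3) ->. Qed.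

Variable F : {fset arrow (label m)}.
Hypothesis FR : F `<=` val D `\ a `\ a' `\ a''.

Let FD : F `<=` val D. Proof. by move: FR; rewrite !fsubsetD1 => /andP[/andP[/andP[]]]. Qed.
Let aF : a \notin F. Proof. by move: FR; rewrite !fsubsetD1 => /andP[/andP[/andP[]]]. Qed.
Let a'F : a' \notin F. Proof. by move: FR; rewrite !fsubsetD1 => /andP[/andP[/andP[]]]. Qed.
Let a''F : a'' \notin F. Proof. by move: FR; rewrite !fsubsetD1 => /andP[/andP[/andP[]]]. Qed.

Let nF c : c \in F -> ~~ in_triple a a' a'' c.
Proof.
by move=> cF; rewrite /in_triple !negb_or; apply/and3P; split;
  [apply: contraNneq aF | apply: contraNneq a'F | apply: contraNneq a''F] => <-.
Qed.

Let mvF : mv @` F = F.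
Proof.
rewrite -[RHS]imfset_id; apply: eq_in_imfset => // c cF /=.
by apply: (move_fix o3); [exact: (fsubsetP FD)|exact: nF].
Qed.

(** Subdiagrams with at most one of the three arrows are the same on both sides. *)
Lemma set_gen_one c : c \in val D -> in_triple a a' a'' c -> g (mv c |` F) = g (c |` F).
Proof.
move=> cD tc; have sub : c |` F `<=` val D by rewrite fsubUset fsub1set cD.
rewrite -{1}mvF -imfsetU1; apply: set_gen_move; first exact: distinct_sub sub (rawP (D := D)).
apply: (exchange_orientation o3) => // x y /fset1UP xF /fset1UP yF tx ty.
case: xF => [->|/nF]; last by rewrite tx.
by case: yF => [->//|/nF]; rewrite ty.
Qed.

(** Subdiagrams with at least two of the three arrows and the same rest form
    the two sides of Q3. *)
Lemma set_gen_many :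
  (g (a |` (a' |` (a'' |` F))) + g (a' |` (a'' |` F)) + g (a |` (a'' |` F)) + g (a |` (a' |` F)))
  - (g (mv a |` (mv a' |` (mv a'' |` F))) + g (mv a' |` (mv a'' |` F)) + g (mv a |` (mv a'' |` F))
     + g (mv a |` (mv a' |` F))) \in relations b m t.
Proof.
have sub : a |` (a' |` (a'' |` F)) `<=` val D by rewrite !fsubUset !fsub1set aD a'D a''D.
have [E EA] := distinct_raw (distinct_sub sub (rawP (D := D))).
have subE : val E `<=` val D by rewrite EA.
have EA' : mv @` val E = mv a |` (mv a' |` (mv a'' |` F)) by rewrite EA !imfsetU1 mvF.
have dE' : distinct_endpoints (mv @` val E).
  apply: distinct_sub (rawP (D := D')); rewrite (omega3_val o3); apply/fsubsetP => _ /imfsetP[c /= cE ->].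
  by apply/imfsetP; exists c => //; exact: (fsubsetP subE).
have [E' EE'] := distinct_raw dE'.
have aE : a \in val E by rewrite EA !inE eqxx.
have a'E : a' \in val E by rewrite EA !inE eqxx orbT.
have a''E : a'' \in val E by rewrite EA !inE eqxx !orbT.
have E'A := etrans EE' EA'.
have nm c : c \in val D -> c \notin F -> mv c \notin F.
  move=> cD; apply: contra => h; have hD := fsubsetP FD _ h; move: (h).
  rewrite -(@move_exchange_inj _ _ _ _ _ _ _ o3 _ _ hD cD) //.
  by rewrite (move_fix o3 hD) //; exact: nF.
have del (x y z : arrow (label m)) (G : {fset arrow (label m)}) (E0 : raw (label m)) :
    x != y -> x != z -> y != z -> x \notin G -> y \notin G -> z \notin G ->
    val E0 = x |` (y |` (z |` G)) ->
    [/\ val (delete E0 x) = y |` (z |` G), val (delete E0 y) = x |` (z |` G) &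
        val (delete E0 z) = x |` (y |` G)].
  move=> xy xz yz xG yG zG e0; rewrite !val_delete e0; split.
  - by apply: fsetU1K; rewrite !inE !negb_or xy xz.
  - by apply: fsetU1D1 => //; rewrite !inE negb_or yz.
  - rewrite [y |` (z |` G)]fsetUCA (fsetUCA [fset x]).
    by apply: fsetU1K; rewrite !inE !negb_or eq_sym xz eq_sym yz.
have [d1 d2 d3] := del a a' a'' F E n1 n2 n3 aF a'F a''F EA.
have [e1 e2 e3] := del (mv a) (mv a') (mv a'') F E' (mv_neq aD a'D n1) (mv_neq aD a''D n2)
  (mv_neq a'D a''D n3) (nm a aD aF) (nm a' a'D a'F) (nm a'' a''D a''F) E'A.
have r : relator t
    ((gen b E + gen b (delete E a) + gen b (delete E a') + gen b (delete E a''))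
     - (gen b E' + gen b (delete E' (mv a)) + gen b (delete E' (mv a'))
        + gen b (delete E' (mv a'')))).
  by apply: Q3 => //; apply: (omega3_sub o3).
by move/relator_rel: r; rewrite -!set_genE d1 d2 d3 e1 e2 e3 EA E'A.
Qed.

End SetSumOmega3.

Lemma set_sum_omega3 b m t (D D' : raw (label m)) a a' a'' :
  omega3 b D D' a a' a'' -> Q3_labels (label_of a) (label_of a') (label_of a'') ->
  set_sum b (val D) - set_sum b (val D') \in relations b m t.
Proof.
move=> o3 q3; have [aD a'D a''D] := omega3_in o3; have [n1 n2 n3] := omega3_neq o3.
pose mv : arrow (label m) -> arrow (label m) := move_arrow (exchange a a' a'').
have mvD' c : c \in val D -> mv c \in val D'.
  by move=> cD; rewrite (omega3_val o3); apply/imfsetP; exists c.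
have mv_neq c c' : c \in val D -> c' \in val D -> c != c' -> mv c != mv c'.
  by move=> cD c'D; apply: contra => /eqP /(move_exchange_inj o3) ->.
have one F : F `<=` val D `\ a `\ a' `\ a'' ->
    [/\ set_gen b (mv a |` F) = set_gen b (a |` F), set_gen b (mv a' |` F) = set_gen b (a' |` F)
      & set_gen b (mv a'' |` F) = set_gen b (a'' |` F)].
  by move=> FR; split; apply: (set_gen_one o3 FR); rewrite /in_triple ?eqxx ?orbT.
have e := sum_fpowersetB3 (And3 aD a'D a''D) (And3 n1 n2 n3)
  (And3 (mvD' _ aD) (mvD' _ a'D) (mvD' _ a''D))
  (And3 (mv_neq _ _ aD a'D n1) (mv_neq _ _ aD a''D n2) (mv_neq _ _ a'D a''D n3))
  (omega3_rest o3) one.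
rewrite /set_sum e big_seq; apply: rpred_sum => F; rewrite fpowersetE.
move=> FR; exact: (set_gen_many t o3 q3 FR).
Qed.

(** * Parity and stages *)

Section Parity.
Variable L : choiceType.
Implicit Types (A R : {fset arrow L}) (a c d : arrow L).

(** Parity and stages only depend on the set of arrows; on sets they can be
    compared for different diagrams without proofs of distinctness. *)
Definition odd_in A a : bool := odd #|` [fset c in A | linked a c]|.

Definition evens A : {fset arrow L} := [fset a in A | ~~ odd_in A a].

Definition stage i A : {fset arrow L} := iter i evens A.

Lemma odd_inE A a : odd_in A a = \big[addb/false]_(c <- A) linked a c.
Proof.
rewrite /odd_in card_fset_sum (big_morph odd oddD (erefl _)).
by apply: eq_bigr => c _; rewrite oddb.
Qed.

Lemma odd_inD1 A a c : c \in A -> odd_in A a = linked a c (+) odd_in (A `\ c) a.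
Proof. by move=> cA; rewrite !odd_inE (big_fsetD1 c). Qed.

Lemma eq_odd_in A a a' : {in A, forall c, linked a c = linked a' c} ->
  odd_in A a = odd_in A a'.
Proof.
by move=> e; rewrite !odd_inE big_seq [RHS]big_seq; apply: eq_bigr.
Qed.

Lemma odd_in_imfset (g : arrow L -> arrow L) A a a' : {in A &, injective g} ->
  {in A, forall c, linked a' (g c) = linked a c} -> odd_in (g @` A) a' = odd_in A a.
Proof.
move=> inj e; rewrite !odd_inE big_imfset //= big_seq [RHS]big_seq.
exact: eq_bigr.
Qed.

Lemma in_evens A a : (a \in evens A) = (a \in A) && ~~ odd_in A a.
Proof. by rewrite !inE. Qed.

Lemma evens_sub A : evens A `<=` A.
Proof. exact: fset_sub. Qed.

Lemma stageS i A : stage i.+1 A = evens (stage i A).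
Proof. by []. Qed.

Lemma stage_mono i j A : (i <= j)%N -> stage j A `<=` stage i A.
Proof.
move=> /subnK <-; elim: (j - i)%N => [|k IH]; first exact: fsubset_refl.
by rewrite addSn; apply: fsubset_trans IH; exact: evens_sub.
Qed.

Lemma stage_sub i A : stage i A `<=` A.
Proof. exact: (stage_mono _ (leq0n i)). Qed.

Lemma evens_imfset (g : arrow L -> arrow L) A : {in A &, injective g} ->
  {in A, forall a, odd_in (g @` A) (g a) = odd_in A a} -> evens (g @` A) = g @` evens A.
Proof.
move=> inj e; apply/fsetP => y; rewrite in_evens; apply/andP/imfsetP => /= [[]|[a]].
  by move=> /imfsetP[a /= aA ->]; rewrite e // => na; exists a; rewrite ?in_evens ?aA.
by rewrite in_evens => /andP[aA na] ->; rewrite e //; split=> //; apply/imfsetP; exists a.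
Qed.

Lemma stage_imfset (g : arrow L -> arrow L) A : {in A &, injective g} ->
  {in A &, forall a c, linked (g a) (g c) = linked a c} ->
  forall i, stage i (g @` A) = g @` stage i A.
Proof.
move=> inj e; elim=> [//|i IH]; rewrite !stageS IH.
have s := fsubsetP (stage_sub i A).
have inj' : {in stage i A &, injective g} by move=> x y /s xA /s yA; exact: inj.
apply: evens_imfset => // a /s aA; apply: odd_in_imfset => // c /s cA; exact: e.
Qed.

(** An arrow linked with no other one is even at all stages and does not
    influence the parity of the others. *)
Lemma stage_unlinked A a : a \in A -> {in A, forall c, linked c a = false} ->
  {in A, forall c, linked a c = false} ->
  forall i, stage i (A `\ a) = stage i A `\ a /\ a \in stage i A.
Proof.
move=> aA ca ac; elim=> [//|i [IH ai]]; rewrite !stageS IH.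
have s := fsubsetP (stage_sub i A).
split; last first.
  rewrite in_evens ai odd_inE big_seq big1 // => c /s; exact: ac.
apply/fsetP => c; rewrite in_evens !in_fsetD1 in_evens -andbA.
case: (eqVneq c a) => //= _; case: (boolP (c \in stage i A)) => //= ci.
by rewrite (odd_inD1 _ ai) ca ?s.
Qed.

(** Two arrows linked with the same arrows have the same parity, and the parity
    of any third arrow does not change when both are deleted. *)
Lemma stage_parallel A a a' : a \in A -> a' \in A -> a != a' ->
  linked a a' = linked a' a -> {in A, forall c, linked c c = false} ->
  {in A, forall c, c != a -> c != a' -> linked c a = linked c a' /\ linked a c = linked a' c} ->
  forall i, stage i (A `\ a `\ a') = stage i A `\ a `\ a' /\
            (a \in stage i A) = (a' \in stage i A).
Proof.
move=> aA a'A aa' sym irr par; elim=> [|i [IH ei]]; first by rewrite aA a'A.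
rewrite !stageS IH; set B := stage i A in IH ei *.
have s : {subset B <= A} := fsubsetP (stage_sub i A).
case: (boolP (a \in B)) => [aB|aB]; last first.
  have a'B : a' \notin B by rewrite -ei.
  have BE : B `\ a `\ a' = B.
    apply/fsetP => c; rewrite !in_fsetD1; case: (eqVneq c a') => [->|_] /=.
      by rewrite (negPf a'B).
    by case: (eqVneq c a) => [->|//]; rewrite (negPf aB).
  rewrite BE !in_evens (negPf aB) (negPf a'B); split=> //.
  apply/fsetP => c; rewrite !in_fsetD1 !in_evens.
  case: (eqVneq c a') => [->|_] /=; first by rewrite (negPf a'B).
  by case: (eqVneq c a) => [->|//]; rewrite (negPf aB).
have a'B : a' \in B by rewrite -ei.
have a'B' : a' \in B `\ a by rewrite in_fsetD1 eq_sym aa'.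
split.
  apply/fsetP => c; rewrite in_evens !in_fsetD1 in_evens -!andbA.
  case: (eqVneq c a') => //= ca'; case: (eqVneq c a) => //= ca.
  case: (boolP (c \in B)) => //= cB; have [e _] := par c (s c cB) ca ca'.
  by rewrite (odd_inD1 c aB) (odd_inD1 c a'B') e addKb.
rewrite !in_evens aB a'B /= !(odd_inD1 _ aB) !(odd_inD1 _ a'B') !irr // sym; congr (~~ _).
rewrite addbCA; congr (_ (+) (_ (+) _)); apply: eq_odd_in => c.
by rewrite !in_fsetD1 => /and3P[ca' ca /s cA]; have [] := par c cA ca ca'.
Qed.

End Parity.

(** * Linking under Reidemeister moves *)

Section LinkMoves.
Variables (L : choiceType) (b : base).
Implicit Types (D : raw L) (a c : arrow L).

Lemma adjacent_endpoint D c p q : c \in val D -> adjacent b D p q ->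
  (forall e, endpoint c e != p) -> (forall e, endpoint c e != q) ->
  between (tail_of c) (head_of c) p = between (tail_of c) (head_of c) q.
Proof.
move=> cD adj np nq; apply: (adjacent_between adj); first exact: tail_in.
- exact: head_in.
- exact: np false.
- exact: nq false.
- exact: np true.
- exact: nq true.
Qed.

Lemma isolated_unlinked D a c : a \in val D -> c \in val D -> isolated b D a ->
  linked c a = false.
Proof.
move=> aD cD iso; case: (eqVneq c a) => [->|ca]; first exact: linkedxx.
have n e e' := neq_endpoint e e' (rawP (D := D)) cD aD ca.
have e := adjacent_endpoint cD iso (fun e => n e false) (fun e => n e true).
by rewrite linkedE /cross e addbb.
Qed.

Lemma omega2_linked D a a' c : omega2 b D a a' -> c \in val D -> c != a -> c != a' ->
  linked c a = linked c a'.
Proof.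
case=> aD a'D _ adjt adjh cD ca ca'.
have n e e' := neq_endpoint e e' (rawP (D := D)) cD aD ca.
have n' e e' := neq_endpoint e e' (rawP (D := D)) cD a'D ca'.
rewrite !linkedE /cross; congr (_ (+) _).
  exact: adjacent_endpoint cD adjt (fun e => n e false) (fun e => n' e false).
exact: adjacent_endpoint cD adjh (fun e => n e true) (fun e => n' e true).
Qed.

(** Among the three matchings of these points exactly one crosses, and it is not
    the one that joins the neighbours [p] and [p']. *)
Lemma cross_swap D p p' u v : adjacent b D p p' ->
  u \in endpoints (val D) -> v \in endpoints (val D) -> uniq [:: p; p'; u; v] ->
  cross p v p' u = ~~ cross p u p' v.
Proof.
move=> adj uE vE; rewrite /= !inE !negb_or.
case/and4P=> /and3P[n1 n2 n3] /andP[n4 n5] n6 _.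
have m := cross_matchings n1 n2 n3 n4 n5 n6.
have e : cross p p' u v = false.
  rewrite cross_sym // /cross (adjacent_between adj) ?addbb // 1?eq_sym //.
by move: m; rewrite e /=; case: (cross p u p' v); case: (cross p v p' u).
Qed.

End LinkMoves.

Section Omega3Linked.
Variables (L : choiceType) (b : base) (D D' : raw L) (a a' a'' : arrow L).
Hypothesis o3 : omega3 b D D' a a' a''.
Let ex := exchange a a' a''.
Let mv : arrow L -> arrow L := move_arrow ex.
Let dD := rawP (D := D).

Let aD : a \in val D. Proof. by case: (omega3_in o3). Qed.
Let a'D : a' \in val D. Proof. by case: (omega3_in o3). Qed.
Let a''D : a'' \in val D. Proof. by case: (omega3_in o3). Qed.

Let mvD' c : c \in val D -> mv c \in val D'.
Proof. by move=> cD; rewrite (omega3_val o3); apply/imfsetP; exists c. Qed.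

Lemma linked_mv_sym c d : c \in val D -> d \in val D -> linked (mv c) (mv d) = linked (mv d) (mv c).
Proof. by move=> cD dD0; apply: linked_sym (rawP (D := D')) _ _; exact: mvD'. Qed.

Lemma triple_neq c d : in_triple a a' a'' c -> ~~ in_triple a a' a'' d -> d != c.
Proof. by move=> tc; apply: contra => /eqP ->. Qed.

Lemma between_mv c d e : c \in val D -> in_triple a a' a'' c -> d \in val D ->
  ~~ in_triple a a' a'' d ->
  between (tail_of d) (head_of d) (ex (endpoint c e)) =
  between (tail_of d) (head_of d) (endpoint c e).
Proof.
move=> cD tc dD0 nd; have [c' [e' [c'D _ tc' ec' adj]]] := exchange_partner o3 e cD tc.
symmetry; apply: (adjacent_endpoint dD0 adj) => e0.
  exact: neq_endpoint dD dD0 cD (triple_neq tc nd).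
by rewrite ec'; exact: neq_endpoint dD dD0 c'D (triple_neq tc' nd).
Qed.

(** An endpoint moves to a neighbouring one, hence to the same side of any chord
    that does not end there. *)
Lemma linked_mv c d : c \in val D -> d \in val D ->
  ~~ (in_triple a a' a'' c && in_triple a a' a'' d) -> linked (mv c) (mv d) = linked c d.
Proof.
have key x y : x \in val D -> y \in val D -> ~~ in_triple a a' a'' x ->
    linked (mv x) (mv y) = linked x y.
  move=> xD yD nx; rewrite {1}/mv (move_fix o3 xD nx).
  case: (boolP (in_triple a a' a'' y)) => [ty|ny]; last by rewrite /mv (move_fix o3 yD ny).
  rewrite !linkedE /cross; congr (_ (+) _).
    exact: (between_mv false yD ty xD nx).
  exact: (between_mv true yD ty xD nx).
move=> cD dD0; rewrite negb_and => /orP[nc|nd]; first exact: key.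
by rewrite linked_mv_sym // key // (linked_sym dD cD dD0).
Qed.

(** The six endpoints of the triple come in three pairs of neighbours, which lie
    on the same side of [c]. *)
Lemma linked_triple c : c \in val D -> ~~ in_triple a a' a'' c ->
  linked c a (+) linked c a' (+) linked c a'' = false.
Proof.
move=> cD nc.
have [[e1 e2 e3 e4] [e5 e6]] := exchange_triple o3.
have ta : in_triple a a' a'' a by rewrite /in_triple eqxx.
have ta' : in_triple a a' a'' a' by rewrite /in_triple eqxx orbT.
have := between_mv false aD ta cD nc; have := between_mv true aD ta cD nc.
have := between_mv true a'D ta' cD nc; rewrite /= /ex e1 e3 e5 !linkedE /cross => -> -> ->.
by case: between; case: between; case: between.
Qed.

(** Two of the three arrows have neighbouring endpoints on exactly one of the
    three intervals. Exchanging these turns one matching of the four points into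
    another, and the third matching, which joins the neighbours, does not cross.
    The endpoints on the two other intervals move within the same side of the
    other chord. *)
Lemma linked_mv_triple :
  [/\ linked (mv a) (mv a') = ~~ linked a a', linked (mv a) (mv a'') = ~~ linked a a''
    & linked (mv a') (mv a'') = ~~ linked a' a''].
Proof.
have [[e1 e2 e3 e4] [e5 e6]] := exchange_triple o3.
have [f1 f2 f3] := omega3_follows o3.
have u := omega3_uniq o3.
(* The neighbours on the three intervals are [x], [x'], then [y], [y'], then [z], [z']. *)
set x := tail_of a in u e1 e2 f1; set x' := tail_of a' in u e1 e2 f1.
set y := head_of a in u e3 e4 f2; set y' := tail_of a'' in u e3 e4 f2.
set z := head_of a' in u e5 e6 f3; set z' := head_of a'' in u e5 e6 f3.
have xE : x \in endpoints (val D) by exact: tail_in.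
have x'E : x' \in endpoints (val D) by exact: tail_in.
have yE : y \in endpoints (val D) by exact: head_in.
have y'E : y' \in endpoints (val D) by exact: tail_in.
have zE : z \in endpoints (val D) by exact: head_in.
have z'E : z' \in endpoints (val D) by exact: head_in.
have adj1 : adjacent b D x x' by rewrite /adjacent f1.
have adj2 : adjacent b D y y' by rewrite /adjacent f2.
have adj3 : adjacent b D z z' by rewrite /adjacent f3.
have t c : tail_of (mv c) = ex (tail_of c) by [].
have h c : head_of (mv c) = ex (head_of c) by [].
rewrite !linkedE !t !h -/x -/x' -/y -/y' -/z -/z' /ex e1 e2 e3 e4 e5 e6 {t h}.
move: u; rewrite /= !inE !negb_or.
move=> /and5P[/and5P[n12 n13 n14 n15 n16] /and4P[n23 n24 n25 n26] /and3P[n34 n35 n36]].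
move=> /andP[n45 n46] /andP[n56 _].
have sl u v p q : u \in endpoints (val D) -> v \in endpoints (val D) -> adjacent b D p q ->
    u != p -> u != q -> v != p -> v != q -> forall r, cross u v p r = cross u v q r.
  move=> uE vE adj up uq vp vq r; rewrite /cross; congr (_ (+) _).
  exact: adjacent_between adj uE vE up uq vp vq.
have ne (p q : nat) : p != q -> q != p by rewrite eq_sym.
have c1 : cross x z x' y = ~~ cross x y x' z.
  by apply: (cross_swap adj1) => //; rewrite /= !inE !negb_or n12 n13 n15 n23 n25 n35.
have c2 : cross y z y' x = ~~ cross y x y' z.
  apply: (cross_swap adj2) => //.
  by rewrite /= !inE !negb_or n34 (ne _ _ n13) n35 (ne _ _ n14) n45 n15.
have c3 : cross z y z' x = ~~ cross z x z' y.
  apply: (cross_swap adj3) => //.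
  by rewrite /= !inE !negb_or n56 (ne _ _ n15) (ne _ _ n35) (ne _ _ n16) (ne _ _ n36) n13.
split.
- transitivity (cross x' y' x z).
    by rewrite (cross_revr x' y' x z') (cross_revr x' y' x z) (sl x' y' z z') // 1?ne.
  rewrite -c1 [LHS]cross_sym // 1?ne // (cross_revr x z x' y') (cross_revr x z x' y).
  by rewrite (sl x z y y') // 1?ne.
- transitivity (cross y z y' x).
    rewrite [LHS]cross_sym // 1?ne // (cross_revr y z y' x).
    by rewrite (sl y z x x') // 1?ne.
  rewrite c2 (crossC x y) (cross_revr y x y' z') (cross_revr y x y' z).
  by rewrite (sl y x z z') // 1?ne.
- transitivity (cross z y z' x).
    by rewrite [LHS]cross_sym // 1?ne // crossC cross_revr.
  rewrite c3 [in RHS]cross_sym // 1?ne // -(sl y' z' x x') // 1?ne //.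
  rewrite [in RHS]cross_sym // 1?ne // -(sl x z y y') // 1?ne //.
  by rewrite crossC cross_revr.
Qed.

End Omega3Linked.

Section Omega3Stage.
Variables (L : choiceType) (b : base) (D D' : raw L) (a a' a'' : arrow L).
Hypothesis o3 : omega3 b D D' a a' a''.
Notation mv := (move_arrow (exchange a a' a'')).
Implicit Type A : {fset arrow L}.

Let aD : a \in val D. Proof. by case: (omega3_in o3). Qed.
Let a'D : a' \in val D. Proof. by case: (omega3_in o3). Qed.
Let a''D : a'' \in val D. Proof. by case: (omega3_in o3). Qed.
Let lsym : {in val D &, forall c d, linked c d = linked d c}.
Proof. by move=> c d; exact: linked_sym (rawP (D := D)). Qed.

Definition all_three A := [&& a \in A, a' \in A & a'' \in A].
Definition at_most_one A := forall c c', c \in A -> c' \in A ->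
  in_triple a a' a'' c -> in_triple a a' a'' c' -> c = c'.

Let odd_in_split A : all_three A -> forall c, odd_in A c =
  linked c a (+) (linked c a' (+) (linked c a'' (+) odd_in (A `\ a `\ a' `\ a'') c)).
Proof.
case/and3P => aA a'A a''A c; have [n1 n2 n3] := omega3_neq o3.
rewrite (odd_inD1 c aA) (@odd_inD1 _ _ c a') ?in_fsetD1 1?eq_sym ?n1 //.
by rewrite (@odd_inD1 _ _ c a'') // !in_fsetD1 eq_sym n3 eq_sym n2.
Qed.

Let rest_triple A c : A `<=` val D -> c \in A `\ a `\ a' `\ a'' ->
  c \in val D /\ ~~ in_triple a a' a'' c.
Proof.
move=> AD /fsetD3P[n1 n2 n3 cA]; split; first exact: (fsubsetP AD).
by rewrite /in_triple !negb_or n1 n2 n3.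
Qed.

(** Each arrow outside the triple is linked with an even number of its members,
    and links inside the triple are counted twice. *)
Lemma odd_in_triple A : A `<=` val D -> all_three A ->
  odd_in A a (+) odd_in A a' (+) odd_in A a'' = false.
Proof.
move=> AD h; rewrite !(odd_in_split h) !linkedxx.
rewrite (lsym a'D aD) (lsym a''D aD) (lsym a''D a'D).
have e : odd_in (A `\ a `\ a' `\ a'') a (+) odd_in (A `\ a `\ a' `\ a'') a'
    (+) odd_in (A `\ a `\ a' `\ a'') a'' = false.
  rewrite !odd_inE -!big_split big_seq big1 //= => c /(rest_triple AD)[cD nc].
  by rewrite !(lsym _ cD) // (linked_triple o3).
move: e; case: odd_in; case: odd_in; case: odd_in => //=;
  by case: linked; case: linked; case: linked.
Qed.

Let mv_inj A : A `<=` val D -> {in A &, injective mv}.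
Proof.
by move=> /fsubsetP s x y /s xD /s yD; exact: (move_exchange_inj o3).
Qed.

Let odd_in_sum A c : A `<=` val D -> odd_in (mv @` A) (mv c) = \big[addb/false]_(d <- A) linked (mv c) (mv d).
Proof. by move=> AD; rewrite odd_inE big_imfset //=; exact: mv_inj. Qed.

(** If all three arrows are present, the links of each with the two others are
    both toggled, which preserves its parity; if at most one is present, no link
    changes. *)
Lemma evens_exchange A : A `<=` val D -> all_three A \/ at_most_one A ->
  evens (mv @` A) = mv @` evens A.
Proof.
move=> AD h; have s := fsubsetP AD; apply: evens_imfset => [|c cA]; first exact: mv_inj.
have out : ~~ in_triple a a' a'' c \/ at_most_one A -> odd_in (mv @` A) (mv c) = odd_in A c.
  move=> h'; apply: odd_in_imfset => [|d dA]; first exact: mv_inj.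
  case: (eqVneq c d) => [<-|cd]; first by rewrite !linkedxx.
  apply: (linked_mv o3); rewrite ?s //; case: h' => [/negPf -> //|one].
  by apply: contra cd => /andP[tc td]; rewrite (one c d).
case: (boolP (in_triple a a' a'' c)) => [tc|nc]; last by apply: out; left.
case: h => [h|]; last by move=> one; apply: out; right.
have [n1 n2 n3] := omega3_neq o3; have [t1 t2 t3] := linked_mv_triple o3.
have [aA a'A a''A] := and3P h.
rewrite odd_in_sum // (big_fsetD1 a) //= (big_fsetD1 a') ?in_fsetD1 1?eq_sym ?n1 //=.
rewrite (big_fsetD1 a'') /=; last by rewrite !in_fsetD1 eq_sym n3 eq_sym n2.
rewrite (_ : \big[_/_]_(_ <- _) _ = odd_in (A `\ a `\ a' `\ a'') c); last first.
  rewrite odd_inE big_seq [RHS]big_seq; apply: eq_bigr => d /(rest_triple AD)[dD nd].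
  by apply: (linked_mv o3) => //; [exact: s | rewrite negb_and nd orbT].
rewrite (odd_in_split h); case/or3P: tc => /eqP ec; subst c; rewrite !linkedxx ?t1 ?t2 ?t3.
- by rewrite !(addNb, addbN) negbK.
- rewrite (linked_mv_sym o3) // t1 (lsym a'D aD).
  by rewrite !(addNb, addbN) negbK.
- rewrite (linked_mv_sym o3) // t2 (linked_mv_sym o3) // t3 (lsym a''D aD) (lsym a''D a'D).
  by rewrite !(addNb, addbN) negbK.
Qed.

(** Since the parities of the triple add up to zero, either all three arrows
    survive a stage or exactly two of them die. *)
Lemma evens_triple A : A `<=` val D -> all_three A ->
  [\/ all_three (evens A),
      [/\ a \in evens A, a' \notin evens A & a'' \notin evens A],
      [/\ a \notin evens A, a' \in evens A & a'' \notin evens A] |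
      [/\ a \notin evens A, a' \notin evens A & a'' \in evens A]].
Proof.
move=> AD h; have := odd_in_triple AD h; have [aA a'A a''A] := and3P h.
rewrite /all_three !in_evens aA a'A a''A /=.
case: odd_in; case: odd_in; case: odd_in => //= _;
  by [constructor 1|constructor 2|constructor 3|constructor 4].
Qed.

Lemma evens_at_most_one A : A `<=` val D -> all_three A \/ at_most_one A ->
  all_three (evens A) \/ at_most_one (evens A).
Proof.
move=> AD [h|one]; last first.
  right=> c c' /(fsubsetP (evens_sub A)) cA /(fsubsetP (evens_sub A)) c'A; exact: one.
case: (evens_triple AD h) => [h'|[h1 h2 h3]|[h1 h2 h3]|[h1 h2 h3]]; first by left.
- by right=> c c' cE c'E /or3P[] /eqP e /or3P[] /eqP e'; subst => //;
     rewrite ?(negPf h2) ?(negPf h3) // in cE c'E.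
- by right=> c c' cE c'E /or3P[] /eqP e /or3P[] /eqP e'; subst => //;
     rewrite ?(negPf h1) ?(negPf h3) // in cE c'E.
- by right=> c c' cE c'E /or3P[] /eqP e /or3P[] /eqP e'; subst => //;
     rewrite ?(negPf h1) ?(negPf h2) // in cE c'E.
Qed.

Lemma stage_exchange i : stage i (val D') = mv @` stage i (val D) /\
  (all_three (stage i (val D)) \/ at_most_one (stage i (val D))).
Proof.
elim: i => [|i [IH h]]; first by split; [exact: omega3_val o3|left; rewrite /all_three aD a'D a''D].
rewrite !stageS IH; split; first exact: evens_exchange (stage_sub _ _) h.
exact: evens_at_most_one (stage_sub _ _) h.
Qed.

End Omega3Stage.

(** * Labels *)

Section Labels.
Variable m : enat.
Implicit Types (D : raw unit) (a : arrow unit).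

Lemma stageE i D : val (iter i (@drop_odd unit) D) = stage i (val D).
Proof.
by elim: i => [//|i IH]; rewrite iterS stageS -IH.
Qed.

(** In this formulation the least stage is the first one that the arrow does not
    reach, because stages decrease. *)
Lemma flabel_dies D a i : (0 < i)%N -> ele (Some i) m -> a \notin stage i (val D) ->
  a \in stage i.-1 (val D) -> flabel_val m D a = Some i.
Proof.
move=> i0 im ai ai1; rewrite /flabel_val; case: pselect => [ex|[]]; last first.
  by exists i; rewrite /dead i0 im stageE.
case: ex_minnP => j /and3P[j0 jm]; rewrite stageE => aj /(_ i); rewrite /dead i0 im stageE ai.
move=> /(_ isT) ji; congr Some; apply/eqP; rewrite eqn_leq ji leqNgt.
apply: contra aj => lt_ji; apply: (fsubsetP (stage_mono _ _)) ai1.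
by rewrite -ltnS prednK.
Qed.

Lemma flabel_survives D a : (forall i, ele (Some i) m -> a \in stage i (val D)) ->
  flabel_val m D a = esucc m.
Proof.
move=> h; rewrite /flabel_val; case: pselect => // ex; case: (ex_minnP ex) => i /and3P[_ im].
by rewrite stageE h.
Qed.

Lemma flabel_later D a i : a \in stage i (val D) -> ele (Some i) m ->
  elt (Some i) (flabel_val m D a).
Proof.
move=> ai im; rewrite /flabel_val; case: pselect => [ex|_].
  case: ex_minnP => j /and3P[j0 jm]; rewrite stageE => aj _; rewrite /elt /= -ltnNge ltnNge.
  by apply: contra aj => ji; apply: (fsubsetP (stage_mono _ ji)) ai.
by case: m im => //= n; rewrite /elt /= -ltnNge.
Qed.

Lemma eq_flabel D D' a a' :
  (forall i, (a \in stage i (val D)) = (a' \in stage i (val D'))) -> flabel m D a = flabel m D' a'.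
Proof.
move=> e; apply: val_inj => /=; rewrite /flabel_val.
have e' i : dead m D a i = dead m D' a' i by rewrite /dead !stageE e.
case: pselect => [ex|nex]; case: pselect => [ex'|nex'] //.
- case: ex_minnP => i hi mi; case: ex_minnP => j hj mj; congr Some; apply/eqP.
  by rewrite eqn_leq mi ?e' // mj // -e'.
- by case: nex'; case: ex => i; rewrite e'; exists i.
- by case: nex; case: ex' => i; rewrite -e'; exists i.
Qed.

End Labels.

(** * Invariance under Reidemeister moves *)

Lemma imfsetD1 (T T' : choiceType) (g : T -> T') (A : {fset T}) x :
  {in A &, injective g} -> x \in A -> g @` (A `\ x) = g @` A `\ g x.
Proof.
move=> inj xA; apply/fsetP => y; rewrite in_fsetD1; apply/imfsetP/andP => /= [[z]|[]].
  rewrite in_fsetD1 => /andP[zx zA] ->; split; last by apply/imfsetP; exists z.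
  by apply: contra zx => /eqP /inj ->.
move=> yx /imfsetP[z /= zA e]; exists z => //; rewrite in_fsetD1 zA andbT.
by apply: contra yx => /eqP ez; rewrite e ez.
Qed.

Section Lambda.
Variables (b : base) (m : enat).
Implicit Types (D : raw unit) (a c : arrow unit).
Notation lab := (label_arrow m).

Lemma label_arrow_inj D D' a a' : lab D a = lab D' a' -> a = a'.
Proof.
case: a a' => [[[t h] s] []] [[[t' h'] s'] []] e.
have -> : t = t' := congr1 (@tail_of _) e.
have -> : h = h' := congr1 (@head_of _) e.
by have -> : s = s' := congr1 (@sign_of _) e.
Qed.

Lemma in_Lambda D a : a \in val D -> lab D a \in val (Lambda_raw m D).
Proof. by move=> aD; apply/imfsetP; exists a. Qed.

Lemma endpoints_Lambda D : endpoints (val (Lambda_raw m D)) =i endpoints (val D).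
Proof.
move=> x; apply/endpointsP/endpointsP => [[_ /imfsetP[a /= aD ->] [e ->]]|[a aD [e ->]]].
  by exists a => //; exists e; case: e.
by exists (lab D a); [exact: in_Lambda | exists e; case: e].
Qed.

(** On both bases linking is expressed by the cyclic order, which homeomorphisms
    preserve. *)
Lemma linked_move phi D a c : a \in val D -> c \in val D ->
  orientation_preserving b phi (endpoints (val D)) ->
  linked (move_arrow phi a) (move_arrow phi c) = linked a c.
Proof.
move=> aD cD h; case: (eqVneq a c) => [->|ac]; first by rewrite !linkedxx.
have inj := orientation_preserving_inj h; have [_ arc] := orientation_circle h.
have n e e' := neq_endpoint e e' (rawP (D := D)) aD cD ac.
have na := neq_tail_head (rawP (D := D)) aD.
have ne p q : p \in endpoints (val D) -> q \in endpoints (val D) -> p != q -> phi p != phi q.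
  by move=> pE qE; apply: contra => /eqP /inj ->.
have E d e : d \in val D -> endpoint d e \in endpoints (val D) by exact: endpoint_in.
have [Eaf Eat] := (E a false aD, E a true aD); have [Ecf Ect] := (E c false cD, E c true cD).
rewrite !linkedE cross_in_arc; [|exact: ne Eaf Ecf (n false false)|exact: ne Eaf Ect (n false true)
  |exact: ne Eat Ecf (n true false)|exact: ne Eat Ect (n true true)|exact: ne Eaf Eat na].
rewrite !arc // cross_in_arc //.
- exact: (n false false).
- exact: (n false true).
- exact: (n true false).
- exact: (n true true).
Qed.

Lemma Lambda_homeomorphic D D' :
  homeomorphic b D D' -> homeomorphic b (Lambda_raw m D) (Lambda_raw m D').
Proof.
case=> phi h e; have inj := move_arrow_inj (rawP (D := D)) (orientation_preserving_inj h).
exists phi; first by apply: orientation_sub h => x; rewrite endpoints_Lambda.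
have st i : stage i (val D') = move_arrow phi @` stage i (val D).
  rewrite e; apply: stage_imfset => // a c aD cD; exact: linked_move h.
have labE a : a \in val D -> lab D' (move_arrow phi a) = move_arrow phi (lab D a).
  move=> aD; rewrite /lab /move_arrow /=; congr (_, _); apply: eq_flabel => i.
  rewrite st; apply/imfsetP/idP => /= [[c ci ec]|ai]; last by exists a.
  by rewrite (inj _ _ aD _ ec) //; apply: (fsubsetP (stage_sub i _)).
apply/fsetP => x; rewrite /= e; apply/imfsetP/imfsetP => /= -[].
  move=> _ /imfsetP[a /= aD ->] ->; exists (lab D a); [exact: in_Lambda|exact: labE].
by move=> _ /imfsetP[a /= aD ->] ->; exists (move_arrow phi a); rewrite ?labE //; apply/imfsetP; exists a.
Qed.

Lemma Lambda_cls D : Lambda m (cls b D) = cls b (Lambda_raw m D).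
Proof.
by symmetry; apply: cls_homeomorphic; apply: Lambda_homeomorphic; exact: homeomorphic_repr.
Qed.

Definition label_sum D : chains b m := set_sum b (val (Lambda_raw m D)).

Lemma subdiagram_sum_Lambda D : subdiagram_sum (Lambda m (cls b D)) = label_sum D.
Proof. by rewrite Lambda_cls subdiagram_sum_cls. Qed.

Lemma val_Lambda_sub D D1 : val D1 `<=` val D ->
  {in val D1, forall a, flabel m D1 a = flabel m D a} ->
  val (Lambda_raw m D1) = lab D @` val D1.
Proof.
move=> sub e; apply: eq_in_imfset => // a aD1.
by rewrite /lab; congr (_, _); exact: e.
Qed.

Lemma isolated_Lambda D a : a \in val D -> isolated b D a -> isolated b (Lambda_raw m D) (lab D a).
Proof.
move=> aD; apply: adjacent_sub => [x||]; rewrite endpoints_Lambda //.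
  exact: tail_in.
exact: head_in.
Qed.

Section Reidemeister.
Variable t : nat.
Notation rel := (relations b m t).

Lemma label_sum_omega1 D a : a \in val D -> isolated b D a ->
  label_sum D - label_sum (delete D a) \in rel.
Proof.
move=> aD iso.
have un c : c \in val D -> linked c a = false by move=> cD; exact: isolated_unlinked aD cD iso.
have un' c : c \in val D -> linked a c = false.
  by move=> cD; rewrite (linked_sym (rawP (D := D))) // un.
have st := stage_unlinked aD un un'.
have lab_a : val (label_of (lab D a)) = esucc m.
  by apply: flabel_survives => i _; case: (st i).
have e : val (Lambda_raw m (delete D a)) = val (Lambda_raw m D) `\ lab D a.
  rewrite (@val_Lambda_sub D) ?val_delete; first 1 last.
  - exact: fsubD1set.
  - move=> c; rewrite in_fsetD1 => /andP[ca cD]; apply: eq_flabel => i.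
    by rewrite val_delete; have [-> _] := st i; rewrite in_fsetD1 ca.
  apply: imfsetD1 => // x y _ _; exact: label_arrow_inj.
rewrite /label_sum e; apply: set_sum_isolated lab_a; first exact: in_Lambda.
exact: isolated_Lambda.
Qed.

Lemma label_sum_omega2 D a a' : omega2 b D a a' ->
  label_sum D - label_sum (delete (delete D a) a') \in rel.
Proof.
move=> o2; case: (o2) => aD a'D sg adjt adjh.
have aa' : a != a' by apply: contra sg => /eqP ->.
have sym := linked_sym (rawP (D := D)).
have st := stage_parallel aD a'D aa' (sym _ _ aD a'D) (fun c _ => linkedxx c).
have {}st := st (fun c cD ca ca' => conj (omega2_linked o2 cD ca ca')
  (etrans (sym _ _ aD cD) (etrans (omega2_linked o2 cD ca ca') (sym _ _ cD a'D)))).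
have e : val (Lambda_raw m (delete (delete D a) a')) = val (Lambda_raw m D) `\ lab D a `\ lab D a'.
  rewrite (@val_Lambda_sub D) !val_delete; first 1 last.
  - exact: fsubset_trans (fsubD1set _ _) (fsubD1set _ _).
  - move=> c; rewrite !in_fsetD1 => /and3P[ca' ca cD]; apply: eq_flabel => i.
    by rewrite !val_delete; have [-> _] := st i; rewrite !in_fsetD1 ca' ca.
  rewrite !imfsetD1 // ?in_fsetD1 1?eq_sym ?aa' // => x y _ _; exact: label_arrow_inj.
rewrite /label_sum e; apply: set_sum_omega2.
  split; [exact: in_Lambda | exact: in_Lambda | exact: sg | | ].
    by apply: adjacent_sub adjt => [x||]; rewrite endpoints_Lambda //; exact: tail_in.
  by apply: adjacent_sub adjh => [x||]; rewrite endpoints_Lambda //; exact: head_in.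
by apply: eq_flabel => i; case: (st i).
Qed.

(** At the first stage up to [m] that not all three arrows reach, two of them
    die, with equal labels, and the third one gets a larger label; if there is no
    such stage, all labels are [m+1]. *)
Lemma omega3_labels D D' a a' a'' : omega3 b D D' a a' a'' ->
  Q3_labels (flabel m D a) (flabel m D a') (flabel m D a'').
Proof.
move=> o3; pose T i := all_three a a' a'' (stage i (val D)).
case: (pselect (forall i, ele (Some i) m -> T i)) => [h|].
  by constructor 4; split; apply: flabel_survives => i /h /and3P[].
move=> /existsNP nT; have ex : exists i, ele (Some i) m && ~~ T i.
  by case: nT => i /not_implyP[im /negP nTi]; exists i; rewrite im.
case: (ex_minnP ex) => -[|i] /andP[im nTi] min.
  by move: nTi; rewrite /T /all_three /=; case: (omega3_in o3) => -> -> ->.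
have Ti : T i.
  apply: contraT => n; suff : (i.+1 <= i)%N by rewrite ltnn.
  by apply: min; rewrite n andbT; case: m im => //= k; exact: ltnW.
have [ai a'i a''i] := and3P Ti.
have dies c : c \in stage i (val D) -> c \notin stage i.+1 (val D) ->
    flabel_val m D c = Some i.+1.
  by move=> ci cn; exact: flabel_dies.
have eqlab c c' : flabel_val m D c = Some i.+1 -> flabel_val m D c' = Some i.+1 ->
    flabel m D c = flabel m D c'.
  by move=> e e'; apply: val_inj; rewrite /= e e'.
case: (evens_triple o3 (stage_sub i _) Ti); rewrite -stageS.
- by move=> h; rewrite /T h in nTi.
- move=> [h1 h2 h3]; constructor 1; split; last by apply: eqlab; exact: dies.
  by rewrite /= (dies _ a'i h2); exact: flabel_later.
- move=> [h1 h2 h3]; constructor 2; split; last by apply: eqlab; exact: dies.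
  by rewrite /= (dies _ ai h1); exact: flabel_later.
- move=> [h1 h2 h3]; constructor 3; split; last by apply: eqlab; exact: dies.
  by rewrite /= (dies _ ai h1); exact: flabel_later.
Qed.

Lemma label_sum_omega3 D D' a a' a'' : omega3 b D D' a a' a'' ->
  label_sum D - label_sum D' \in rel.
Proof.
move=> o3; have [aD a'D a''D] := omega3_in o3; have [f1 f2 f3] := omega3_follows o3.
pose mv : arrow unit -> arrow unit := move_arrow (exchange a a' a'').
have inj : {in val D &, injective mv} := move_exchange_inj o3.
have labE c : c \in val D -> lab D' (mv c) = move_arrow (exchange a a' a'') (lab D c).
  move=> cD; rewrite /lab /move_arrow /=; congr (_, _); apply: eq_flabel => i.
  have [-> _] := stage_exchange o3 i; apply/imfsetP/idP => /= [[d di ec]|ci]; last by exists c.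
  by rewrite (inj _ _ cD _ ec) //; apply: (fsubsetP (stage_sub i _)).
apply: (@set_sum_omega3 _ _ _ _ _ (lab D a) (lab D a') (lab D a'')); last exact: omega3_labels o3.
split; first by split; exact: in_Lambda.
- by case: o3.
- have s : {subset endpoints (val (Lambda_raw m D)) <= endpoints (val D)}.
    by move=> x; rewrite endpoints_Lambda.
  by split; [apply: follows_sub s _ _ f1|apply: follows_sub s _ _ f2|apply: follows_sub s _ _ f3];
    rewrite endpoints_Lambda ?tail_in ?head_in.
apply/fsetP => x; rewrite /= (omega3_val o3); apply/imfsetP/imfsetP => /= -[].
  by move=> _ /imfsetP[c /= cD ->] ->; exists (lab D c); [exact: in_Lambda|exact: labE].
by move=> _ /imfsetP[c /= cD ->] ->; exists (mv c); [apply/imfsetP; exists c|rewrite labE].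
Qed.

Lemma proj_eq (x y : chains b m) : x - y \in rel -> proj t x = proj t y.
Proof. by move=> h; apply/eqP; rewrite -Quotient.idealrBE. Qed.

Lemma lattice_map_cls (v : {additive lattice_group b m t -> rat}) D :
  lattice_map v (cls b D) = v (proj t (label_sum D)).
Proof. by rewrite /lattice_map subdiagram_sum_Lambda. Qed.

Lemma lattice_map_invariant (v : {additive lattice_group b m t -> rat}) :
  vknot_invariant (lattice_map v).
Proof.
move=> E E'; elim=> {E E'} [_ _ [D a aD iso|D a a' o2|D D' a a' a'' o3]|E|E E' _ ->|E F G _ -> _ ->] //;
  rewrite !lattice_map_cls; congr (v _); apply: proj_eq.
- exact: label_sum_omega1.
- exact: label_sum_omega2.
- exact: label_sum_omega3 o3.
Qed.

End Reidemeister.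
End Lambda.

Lemma proj_is_zmod_morphism b m t : zmod_morphism (@proj b m t).
Proof. exact: pi_is_zmod_morphism. Qed.

HB.instance Definition _ b m t :=
  GRing.isZmodMorphism.Build (chains b m) (lattice_group b m t) (@proj b m t)
    (@proj_is_zmod_morphism b m t).

Lemma proj0 b m t (x : chains b m) : x \in relations b m t -> proj t x = 0.
Proof. by move=> h; rewrite (@proj_eq _ _ _ x 0) ?subr0 ?raddf0. Qed.

(** * Crossing changes *)

Section Kauffman.
Variables (b : base) (m : enat) (t : nat) (v : {additive lattice_group b m t -> rat}).
Variable D : raw unit.
Implicit Types (T G : {fset arrow unit}) (a c : arrow unit).

Lemma reverse_in_inj_tail T : {in val D &, forall a c,
  tail_of (reverse_in T a) = tail_of (reverse_in T c) -> a = c}.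
Proof.
move=> a c aD cD; rewrite -[tail_of _]/(endpoint _ false) -[RHS]/(endpoint _ false).
by rewrite !endpoint_reverse_in => /(rawP aD cD)[].
Qed.

Lemma reverse_in_inj T : {in val D &, injective (reverse_in T)}.
Proof. by move=> a c aD cD e; apply: (@reverse_in_inj_tail T); rewrite ?e. Qed.

Lemma linked_reverse_in T a c : a \in val D -> c \in val D ->
  linked (reverse_in T a) (reverse_in T c) = linked a c.
Proof.
move=> aD cD; rewrite !linkedE /reverse_in; case: ifP => _; case: ifP => _ //.
- by rewrite crossC cross_revr.
- by rewrite crossC.
- by rewrite cross_revr.
Qed.

(** The label is the one in [D]: crossing changes preserve linking, so that they
    commute with the passage to the next stage. *)
Definition reversed_label T a : arrow (label m) :=
  let x := reverse_in T a in (tail_of x, head_of x, sign_of x, flabel m D a).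

Lemma Lambda_reversed T : val (Lambda_raw m (reversed D T)) = reversed_label T @` val D.
Proof.
have st i : stage i (val (reversed D T)) = reverse_in T @` stage i (val D).
  by apply: stage_imfset; [exact: reverse_in_inj | exact: linked_reverse_in].
have e a : a \in val D -> label_arrow m (reversed D T) (reverse_in T a) = reversed_label T a.
  move=> aD; congr (_, _); apply: eq_flabel => i; rewrite st.
  apply/imfsetP/idP => /= [[c ci ec]|ai]; last by exists a.
  by rewrite (reverse_in_inj aD _ ec) //; apply: (fsubsetP (stage_sub i _)).
apply/fsetP => x; apply/imfsetP/imfsetP => /= -[].
  by move=> _ /imfsetP[a /= aD ->] ->; exists a; rewrite ?e.
by move=> a aD ->; exists (reverse_in T a); rewrite ?e //; apply/imfsetP; exists a.
Qed.

Lemma reversed_label_inj T : {in val D &, injective (reversed_label T)}.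
Proof.
move=> a c aD cD e; have : endpoint (reversed_label T a) false = endpoint (reversed_label T c) false.
  by rewrite e.
by move/(reverse_in_inj_tail aD cD).
Qed.

Definition subset_value (F : {fset arrow (label m)}) : rat := v (proj t (set_gen b F)).

Lemma subset_value_gt F : (t < #|` F|)%N -> subset_value F = 0.
Proof.
move=> tF; rewrite /subset_value /set_gen; case: insubP => [E _ EF|_] /=; last by rewrite !raddf0.
by rewrite proj0 ?raddf0 //; apply: relator_rel; apply: Truncation; rewrite EF.
Qed.

Lemma lattice_map_reversed T : lattice_map v (cls b (reversed D T)) =
  \sum_(G <- fpowerset (val D)) subset_value (reversed_label T @` G).
Proof.
rewrite lattice_map_cls /label_sum /set_sum Lambda_reversed !raddf_sum /=.
rewrite (sum_fpowerset_imfset (fun F => subset_value F)) //.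
exact: reversed_label_inj.
Qed.

(** A subset of at most [t] arrows misses some arrow of [S], and crossing changes
    at that arrow cancel in pairs. *)
Lemma alternating_reversed (S : {fset arrow unit}) : (t < #|` S|)%N ->
  \sum_(T <- fpowerset S) (-1) ^+ #|` T| * lattice_map v (cls b (reversed D T)) = 0.
Proof.
move=> tS; under eq_bigr => T _ do rewrite lattice_map_reversed mulr_sumr.
rewrite exchange_big big_seq big1 //= => G; rewrite fpowersetE => GD.
have [tG|Gt] := ltnP t #|` G|.
  apply: big1 => T _; rewrite subset_value_gt ?mulr0 // card_in_imfset // => x y xG yG.
  by apply: reversed_label_inj; apply: (fsubsetP GD).
have /fsubsetPn[s sS sG] : ~~ (S `<=` G).
  by apply: contraL tS => /fsubset_leq_card SG; rewrite -leqNgt (leq_trans SG).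
rewrite (sum_fpowersetD1 _ sS) big_seq big1 // => T; rewrite fpowersetE fsubsetD1 => /andP[_ sT].
have e : reversed_label (s |` T) @` G = reversed_label T @` G.
  apply: eq_in_imfset => // a aG; rewrite /reversed_label /reverse_in in_fset1U.
  by case: (eqVneq a s) => // as_; rewrite -as_ aG in sG.
by rewrite e cardfsU1 sT exprS mulN1r mulNr subrr.
Qed.

End Kauffman.

Lemma lattice_map_finite_type b m t (v : {additive lattice_group b m t -> rat}) :
  kauffman_finite_type (lattice_map v).
Proof. by exists t => D S _; exact: alternating_reversed. Qed.

(** * Finitely many diagrams with few arrows *)

Lemma card_lt_witness (T : choiceType) (A B : {fset T}) x : {subset A <= B} ->
  x \in B -> x \notin A -> (#|` A| < #|` B|)%N.
Proof.
move=> AB xB xA; apply: fproper_ltn_card; rewrite fproperE; apply/andP; split.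
  exact/fsubsetP.
by apply/fsubsetPn; exists x.
Qed.

Lemma in_fset_filter (T : choiceType) (A : {fset T}) (P : pred T) x :
  (x \in [fset y in A | P y]) = (x \in A) && P x.
Proof. by rewrite !inE. Qed.

Section Normal.
Variables (L : choiceType) (b : base).
Implicit Types D : raw L.

(** Up to homeomorphism a diagram with [n] arrows has its endpoints at positions
    below [2n]: replace each endpoint by its rank. *)
Lemma homeomorphic_bounded D : exists2 D', homeomorphic b D D' &
  #|` val D'| = #|` val D| /\
  {in val D', forall a, exists2 a0, a0 \in val D & [/\ sign_of a = sign_of a0,
    label_of a = label_of a0 & forall e, (endpoint a e < 2 * #|` val D|)%N]}.
Proof.
set E := endpoints (val D).
pose rank x := #|` [fset y in E | (y < x)%N]|.
have rank_lt x y : x \in E -> (x < y)%N -> (rank x < rank y)%N.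
  move=> xE xy; apply: (@card_lt_witness _ _ _ x) => [z||].
  - by rewrite !in_fset_filter => /andP[-> zx]; exact: ltn_trans xy.
  - by rewrite in_fset_filter xE.
  - by rewrite in_fset_filter ltnn andbF.
have mono : {in E &, {mono rank : p q / (p < q)%N}}.
  move=> p q pE qE; case: (ltngtP p q) => [|/(rank_lt _ _ qE)|->]; rewrite ?ltnn //.
    exact: rank_lt.
  by move/ltnW; rewrite leqNgt => /negPf.
have h : orientation_preserving b rank E.
  case: b => //; exact: (orientation_circle (b := Line) mono).
have inj := orientation_preserving_inj h.
have [D' D'E] := distinct_raw (distinct_move (rawP (D := D)) inj).
have cardE : (#|` E| <= 2 * #|` val D|)%N.
  rewrite /E /endpoints cardfsU mul2n -addnn.
  by apply: leq_trans (leq_subr _ _) (leq_add _ _); exact: leq_imfset_card.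
exists D'; first by exists rank.
split; first by rewrite D'E card_in_imfset //; exact: move_arrow_inj (rawP (D := D)) inj.
move=> _ /[!D'E] /imfsetP[a /= aD ->]; exists a => //; split=> // e.
rewrite endpoint_move; apply: leq_trans cardE.
apply: (@card_lt_witness _ _ _ (endpoint a e)) => [z||].
- by rewrite in_fset_filter => /andP[].
- exact: endpoint_in.
- by rewrite in_fset_filter ltnn andbF.
Qed.

Definition bounded_arrows (n : nat) (l : seq L) : seq (arrow L) :=
  [seq (x, c) | x <- [seq (y, e) | y <- [seq (p, q) | p <- iota 0 n, q <- iota 0 n],
                                   e <- [:: true; false]], c <- l].

Definition bounded_diagrams (n : nat) (l : seq L) : seq (diagram L b) :=
  undup [seq cls b D | D <- pmap insub (fpowerset [fset a in bounded_arrows n l])].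

Lemma mem_bounded_diagrams n (l : seq L) D : (2 * #|` val D| <= n)%N ->
  {in val D, forall a, label_of a \in l} -> cls b D \in bounded_diagrams n l.
Proof.
move=> dn lab; have [D' h [cD' bD']] := homeomorphic_bounded D.
rewrite (cls_homeomorphic h) mem_undup; apply: map_f; rewrite mem_pmap.
apply/mapP; exists (val D'); last by rewrite valK.
rewrite fpowersetE; apply/fsubsetP => a /bD'[a0 a0D [_ la lt]]; rewrite inE /=.
case: a la lt => [[[p q] e] c] la lt.
apply: allpairs_f; last by rewrite -[c]/(label_of (p, q, e, c)) la lab.
apply: allpairs_f; last by case: (e).
by apply: allpairs_f; rewrite mem_iota /= add0n; apply: leq_trans dn; [exact: (lt false)|exact: (lt true)].
Qed.

End Normal.

(** * Pairings and functionals on the lattice groups *)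

Section Pairing.
Variables (b : base) (m : enat).
Implicit Types (x y F : chains b m).

Lemma pairing_is_zmod_morphism F : zmod_morphism (pairing F).
Proof.
move=> x y; rewrite /pairing -sumrB; apply: eq_bigr => E _.
by rewrite coeffB mulrBr.
Qed.

HB.instance Definition _ F :=
  GRing.isZmodMorphism.Build (chains b m) int (pairing F) (pairing_is_zmod_morphism F).

Lemma sum_delta_seq (T : choiceType) (l : seq T) (c : T -> int) (x : T) : uniq l ->
  \sum_(y <- l) c y * (y == x)%:R = if x \in l then c x else 0.
Proof.
move=> ul; transitivity (\sum_(y <- l | y == x) c y).
  rewrite [RHS]big_mkcond; apply: eq_bigr => y _.
  by case: (y == x); rewrite ?mulr1 ?mulr0.
case: ifP => xl.
  by rewrite big_mkcond (bigD1_seq x) //= eqxx big1 ?addr0 // => y /negPf ->.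
by rewrite big_seq_cond big1 // => y /andP[yl /eqP yx]; rewrite -yx yl in xl.
Qed.

Lemma pairing_gen F D : pairing F (gen b D) = coeff (cls b D) F.
Proof.
rewrite /pairing /gen; move: (cls b D) => E0.
under eq_bigr => E _ do rewrite coeffU mul1r eq_sym.
rewrite sum_delta_seq ?uniq_dom //; case: ifP => // /negbT out.
by rewrite coeff_outdom.
Qed.

Lemma coeff_sum_seq (l : seq (sdiagram b m)) (c : sdiagram b m -> int) E : uniq l ->
  coeff E (\sum_(E' <- l) << c E' *g E' >>) = if E \in l then c E else 0.
Proof.
move=> ul; rewrite raddf_sum -sum_delta_seq //; apply: eq_bigr => E' _.
exact: coeffU.
Qed.

Lemma lattice_functional t (phi : {additive chains b m -> int}) :
  (forall x, relator t x -> phi x = 0) ->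
  exists v : {additive lattice_group b m t -> rat}, forall x, (phi x)%:~R = v (proj t x).
Proof.
move=> kill; have killr x : x \in relations b m t -> phi x = 0.
  by move=> /asboolP; elim=> [y /kill //||y z _ ey _ ez]; rewrite ?raddf0 // raddfB ey ez subrr.
pose f (y : lattice_group b m t) : rat := (phi (repr y))%:~R.
have fE x : f (proj t x) = (phi x)%:~R.
  congr _%:~R; apply/eqP; rewrite -subr_eq0 -raddfB; apply/eqP/killr.
  by rewrite Quotient.idealrBE reprK.
have fB : zmod_morphism f.
  move=> y z; rewrite -[y]reprK -[z]reprK -!/(proj t _) -raddfB !fE.
  by rewrite raddfB intrB.
pose fM := GRing.isZmodMorphism.Build _ _ f fB.
pose v : {additive lattice_group b m t -> rat} := HB.pack f fM.
by exists v => x; rewrite -fE.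
Qed.

End Pairing.

(** * The formula for products of signed arrow counts *)

Section Theta.
Variables (b : base) (m : enat) (s : nat) (k t : 'I_s -> nat).
Hypothesis k_le : forall j, (0 < k j)%N /\ ele (Some (k j)) m.
Notation V := {ffun 'I_s -> int}.
Notation A_m := (arrow (label m)).
Notation N := (\sum_(j < s) t j)%N.

Definition coordinate (j : 'I_s) (x : V) : int := x j.

Lemma coordinate_is_zmod_morphism j : zmod_morphism (coordinate j).
Proof. by move=> x y; rewrite /coordinate !ffunE. Qed.

HB.instance Definition _ j :=
  GRing.isZmodMorphism.Build V int (coordinate j) (coordinate_is_zmod_morphism j).

Definition monomial (x : V) : int := \prod_(j < s) x j ^+ t j.

Lemma degree_monomial : degree_lt N.+1 monomial.
Proof.
rewrite /monomial; elim: (index_enum _) => [|j r IH].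
  by rewrite big_nil => u x; rewrite /difference !big_nil subrr.
apply: (@eq_degree_lt _ _ (fun x : V => (\prod_(i <- r) x i ^+ t i) * x j ^+ t j)).
  by move=> x; rewrite big_cons mulrC.
rewrite big_cons; elim: (t j) => [|e IHe].
  by apply: eq_degree_lt IH => x; rewrite mulr1.
apply: eq_degree_lt (degree_ltM (coordinate j) IHe) => x.
by rewrite exprS /= /coordinate; ring.
Qed.

Definition weight (a : A_m) : V :=
  [ffun j => if val (label_of a) == Some (k j) then (if sign_of a then 1 else -1) else 0].

Lemma theta_weight_sum j (E : sdiagram b m) : theta (k j) E = weight_sum weight (val (repr E)) j.
Proof.
rewrite /theta /weight_sum sum_ffunE !card_fset_sum !(big_morph Posz PoszD (erefl _)) -sumrB.
apply: eq_bigr => a _; rewrite !ffunE.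
by case: (sign_of a) => /=; case: (val (label_of a) == Some (k j)).
Qed.

Lemma theta_prod_weight_sum (E : sdiagram b m) :
  theta_prod k t E = monomial (weight_sum weight (val (repr E))).
Proof. by apply: eq_bigr => j _; rewrite theta_weight_sum. Qed.

(** The coefficient is a function of the signs and labels only, so that it does
    not depend on the choice of coordinates for a diagram. *)
Definition theta_coeff (A : {fset A_m}) : int := mobius weight monomial A.

Lemma theta_coeff_move phi A : distinct_endpoints A -> {in endpoints A &, injective phi} ->
  theta_coeff (move_arrow phi @` A) = theta_coeff A.
Proof. by move=> d inj; apply: mobius_imfset => //; exact: move_arrow_inj. Qed.

Lemma theta_coeff_cls D : theta_coeff (val (repr (cls b D))) = theta_coeff (val D).
Proof.
have [phi h ->] := homeomorphic_repr b D.
exact: theta_coeff_move (rawP (D := D)) (orientation_preserving_inj h).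
Qed.

Lemma theta_coeff_gt A : (N < #|` A|)%N -> theta_coeff A = 0.
Proof. by move=> NA; apply: mobius_degree degree_monomial NA. Qed.

Lemma theta_coeff_label A a : a \in A -> (forall j, val (label_of a) <> Some (k j)) ->
  theta_coeff A = 0.
Proof.
move=> aA nl; apply: (mobius_weight0 _ aA); apply/ffunP => j; rewrite !ffunE.
by case: eqP => // /nl.
Qed.

Lemma last_label_neq (l : label m) j : val l = esucc m -> val l <> Some (k j).
Proof.
by move=> -> ; case: m (k_le j) => [n|] //= [_ kn] [e]; move: kn; rewrite -e ltnn.
Qed.

Definition theta_labels : seq (label m) := pmap insub [seq Some (k j) | j <- enum 'I_s].

(** All other diagrams have coefficient 0: they have more than [N] arrows or a
    label that is not counted, and [N] arrows have [2N] endpoints. *)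
Definition theta_formula : chains b m :=
  \sum_(E <- bounded_diagrams b (2 * N) theta_labels) << theta_coeff (val (repr E)) *g E >>.

Lemma coeff_theta_formula D : coeff (cls b D) theta_formula = theta_coeff (val D).
Proof.
rewrite (coeff_sum_seq (fun E => theta_coeff (val (repr E)))) ?undup_uniq // theta_coeff_cls.
case: ifP => // /negP out; apply/esym/eqP/negP => nz; apply: out.
have small : (#|` val D| <= N)%N.
  by rewrite leqNgt; apply/negP => /theta_coeff_gt e; apply: nz; rewrite e.
apply: mem_bounded_diagrams; first by rewrite leq_mul2l small orbT.
move=> a aD; rewrite mem_pmap; apply/mapP.
case: (pselect (exists j, val (label_of a) = Some (k j))) => [[j e]|none].
  exists (val (label_of a)); last by rewrite valK.
  by rewrite e; apply: map_f; rewrite mem_enum.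
case: nz; apply/eqP/(theta_coeff_label aD) => j e; apply: none; by exists j.
Qed.

Lemma pairing_theta D : pairing theta_formula (gen b D) = theta_coeff (val D).
Proof. by rewrite pairing_gen coeff_theta_formula. Qed.

Lemma theta_formula_relator x : relator N x -> pairing theta_formula x = 0.
Proof.
case=> {x} [D a aD _ la|D a a' o2 lab|D D' a a' a'' o3 _|D DN].
- by rewrite pairing_theta; apply: (theta_coeff_label aD) => j; exact: last_label_neq.
- have aa' := omega2_neq o2; case: o2 => aD a'D sg _ _.
  have w : weight a + weight a' = 0.
    apply/ffunP => j; rewrite !ffunE lab; case: (_ == _) => //.
    by move: sg; case: (sign_of a); case: (sign_of a') => //= _; rewrite ?subrr ?addNr.
  rewrite !raddfD /= !pairing_theta !val_delete.
  exact: mobius_opposite aD a'D aa' w.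
- have inj := move_exchange_inj o3.
  have e A : A `<=` val D -> theta_coeff (move_arrow (exchange a a' a'') @` A) = theta_coeff A.
    by move=> /fsubsetP sub; apply: mobius_imfset => // x y /sub xD /sub yD; exact: inj.
  have [aD a'D a''D] := omega3_in o3.
  have e0 : theta_coeff (val D') = theta_coeff (val D).
    by rewrite (omega3_val o3); apply: e; exact: fsubset_refl.
  have del x : x \in val D ->
      theta_coeff (val (delete D' (move_arrow (exchange a a' a'') x))) = theta_coeff (val (delete D x)).
    move=> xD; rewrite !val_delete (omega3_val o3) -(imfsetD1 inj xD).
    by apply: e; exact: fsubD1set.
  have pD x y : pairing theta_formula (x + y) = pairing theta_formula x + pairing theta_formula y.
    exact: raddfD.
  have pB x y : pairing theta_formula (x - y) = pairing theta_formula x - pairing theta_formula y.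
    exact: raddfB.
  rewrite /= pB !pD !pairing_theta.
  by rewrite e0 (del a aD) (del a' a'D) (del a'' a''D) subrr.
- by rewrite pairing_theta; exact: theta_coeff_gt.
Qed.

Lemma theta_formula_functional :
  exists v : {additive lattice_group b m N -> rat},
    forall x : chains b m, (pairing theta_formula x)%:~R = v (proj _ x).
Proof. exact: lattice_functional theta_formula_relator. Qed.

Lemma theta_prod_pairing (E : sdiagram b m) :
  theta_prod k t E = pairing theta_formula (subdiagram_sum E).
Proof.
rewrite theta_prod_weight_sum -sum_mobius subdiagram_sum_repr /set_sum raddf_sum big_seq [RHS]big_seq.
apply: eq_bigr => F; rewrite fpowersetE => FE.
have [D DF] := distinct_raw (distinct_sub FE (rawP (D := repr E))).
by rewrite /= -DF set_genE pairing_theta.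
Qed.

End Theta.

(** * Chain diagrams *)

Section Chain.

(** The tails are the even numbers and the heads are odd; consecutive intervals
    overlap and all others are disjoint. *)
Definition chain_arrow (i : nat) : arrow unit := (2 * i, 2 * i + 3, true, tt)%N.

Lemma chain_arrow_inj : injective chain_arrow.
Proof.
by move=> i j /(congr1 (@tail_of _)); rewrite /tail_of /= => /eqP; rewrite eqn_mul2l => /eqP.
Qed.

Definition chain_set (lo hi : nat) : {fset arrow unit} :=
  [fset chain_arrow i | i in index_iota lo hi].

Lemma mem_chain lo hi i : (chain_arrow i \in chain_set lo hi) = (lo <= i < hi)%N.
Proof. by rewrite mem_imfset /= ?mem_index_iota //; exact: chain_arrow_inj. Qed.

Lemma chain_setP lo hi a :
  reflect (exists2 i, (lo <= i < hi)%N & a = chain_arrow i) (a \in chain_set lo hi).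
Proof.
apply: (iffP idP) => [/imfsetP[i /= h ->]|[i h ->]]; last by rewrite mem_chain.
by exists i; rewrite // -mem_index_iota.
Qed.

Lemma linked_chain i j : linked (chain_arrow i) (chain_arrow j) = (i == j.+1) || (j == i.+1).
Proof. by rewrite linkedE /cross /between /tail_of /head_of /=; lia. Qed.

Lemma big_addb_eq (T : eqType) (l : seq T) x : uniq l ->
  \big[addb/false]_(y <- l) (y == x) = (x \in l).
Proof.
elim: l => [|y l IH] /=; first by rewrite big_nil.
by case/andP=> yl ul; rewrite big_cons IH // inE eq_sym; case: eqVneq => // ->; rewrite (negPf yl).
Qed.

(** The two terms are the links with the preceding and the following arrow. *)
Lemma odd_in_chain lo hi i : (lo <= i < hi)%N ->
  odd_in (chain_set lo hi) (chain_arrow i) = (lo < i)%N (+) (i.+1 < hi)%N.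
Proof.
move=> /andP[li ih]; rewrite odd_inE.
pose before c := (0 < i)%N && (c == chain_arrow i.-1).
transitivity (\big[addb/false]_(c <- chain_set lo hi) (before c (+) (c == chain_arrow i.+1))).
  rewrite big_seq [RHS]big_seq; apply: eq_bigr => _ /chain_setP[j _ ->].
  by rewrite /before linked_chain !(inj_eq chain_arrow_inj); lia.
rewrite big_split /= big_addb_eq ?fset_uniq // mem_chain; congr (_ (+) _); last by lia.
rewrite /before; case: i li ih {before} => [|i] li ih; first by rewrite big1.
by rewrite big_addb_eq ?fset_uniq // mem_chain; lia.
Qed.

(** The two ends of a chain are odd and all other arrows are even; the length is
    even at all stages, so the chain never shrinks to a single arrow, which would
    be even. *)
Lemma stage_chain n i x :
  (chain_arrow x \in stage i (chain_set 0 n.*2)) = (i <= x < n.*2 - i)%N.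
Proof.
elim: i x => [|i IH] x; first by rewrite mem_chain subn0.
have -> : stage i.+1 (chain_set 0 n.*2) = evens (chain_set i (n.*2 - i)).
  rewrite stageS; congr evens; apply/fsetP => a; apply/idP/chain_setP => [ai|[j h ->]]; last by rewrite IH.
  have /chain_setP[j _ aj] := fsubsetP (stage_sub _ _) a ai.
  by exists j => //; rewrite -IH -aj.
rewrite in_evens mem_chain; case: (boolP (i <= x < n.*2 - i)%N) => h /=; last by lia.
by rewrite odd_in_chain //; lia.
Qed.

Lemma chain_distinct n : distinct_endpoints (chain_set 0 n).
Proof.
move=> _ _ /chain_setP[i _ ->] /chain_setP[j _ ->] e e'.
by case: e; case: e'; rewrite /endpoint /tail_of /head_of /= => h; have := h; try lia;
  move=> _; congr (chain_arrow _, _); lia.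
Qed.

Lemma flabel_chain_le m n (D : raw unit) a : val D = chain_set 0 n.*2 -> a \in val D ->
  ele (Some n) m -> (0 < n)%N -> exists2 i, (i <= n)%N & flabel_val m D a = Some i.
Proof.
move=> DE aD nm n0; have /chain_setP[x _ ax] : a \in chain_set 0 n.*2 by rewrite -DE.
rewrite /flabel_val; case: pselect => [ex|[]]; last first.
  by exists n; rewrite /dead n0 nm stageE DE ax stage_chain; lia.
case: ex_minnP => i _ min; exists i => //; apply: min.
by rewrite /dead n0 nm stageE DE ax stage_chain; lia.
Qed.

(** The two middle arrows are the last ones to survive. *)
Lemma flabel_chain_mid m n (D : raw unit) : val D = chain_set 0 n.*2 -> ele (Some n) m ->
  (0 < n)%N -> flabel_val m D (chain_arrow n.-1) = Some n.
Proof.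
move=> DE nm n0; apply: flabel_dies => //; rewrite DE stage_chain; lia.
Qed.

End Chain.

(** * Linear independence *)

Section Independence.
Variables (b : base) (t : nat).
Hypothesis t_gt0 : (0 < t)%N.

Definition theta_power (k : nat) (D : gauss b) : rat :=
  (theta_prod (fun=> k : nat) (fun=> t : nat) (Lambda None D : sdiagram b None) (s := 1))%:~R.

Lemma theta_power_column k : (0 < k)%N -> column t (theta_power k).
Proof.
move=> k0; exists None; split=> //.
have kle (j : 'I_1) : (0 < k)%N /\ ele (Some k) None by [].
have [v hv] := theta_formula_functional b (k := fun=> k) (fun=> t) kle.
have {}hv D : theta_power k D = lattice_map v D.
  by rewrite /theta_power theta_prod_pairing hv.
by move: v hv; rewrite big_ord1 => v hv; exists v.
Qed.

Lemma theta_power_cls k D : theta_power k (cls b D) =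
  (\sum_(a <- val (Lambda_raw None D)) weight (fun _ : 'I_1 => k) a ord0)%:~R ^+ t.
Proof.
rewrite /theta_power /theta_prod big_ord1 rmorphXn /=; congr (_%:~R ^+ t).
rewrite [theta _ _](theta_weight_sum (fun _ : 'I_1 => k) ord0) Lambda_cls.
have [phi h ->] := homeomorphic_repr b (Lambda_raw None D).
rewrite -sum_ffunE; congr (fun_of_fin _ _).
apply: weight_sum_imfset => //.
exact: move_arrow_inj (rawP (D := _)) (orientation_preserving_inj h).
Qed.

Lemma exists_chain n : exists D : raw unit, val D = chain_set 0 n.*2.
Proof. exact: distinct_raw (@chain_distinct _). Qed.

Lemma theta_power_chain k n (D : raw unit) : val D = chain_set 0 n.*2 -> (0 < n)%N ->
  ((n < k)%N -> theta_power k (cls b D) = 0) /\ theta_power n (cls b D) != 0.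
Proof.
move=> DE n0; split=> [nk|]; rewrite theta_power_cls.
  rewrite big_seq big1 ?expr0n ?(gtn_eqF t_gt0) // => _ /imfsetP[a /= aD ->].
  have [i ik e] := flabel_chain_le DE aD isT n0 (m := None).
  rewrite ffunE /= e; case: eqP => // -[ei]; move: nk; rewrite -ei; lia.
rewrite expf_eq0 t_gt0 /= intr_eq0.
have inj : {in val D &, injective (label_arrow None D)}.
  by move=> x y _ _; exact: label_arrow_inj.
rewrite sum_imfset // DE.
have c : chain_arrow n.-1 \in chain_set 0 n.*2 by rewrite mem_chain; lia.
rewrite (big_fsetD1 _ c) /= ffunE /= flabel_chain_mid // eqxx.
rewrite lt0r_neq0 // ltr_wpDr // big_seq sumr_ge0 // => a.
rewrite in_fsetD1 => /andP[_ /chain_setP[i _ ->]]; rewrite ffunE /=.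
by case: ifP.
Qed.

(** If [n] functions spanned the column, the matrix of the values of [n+1] of the
    powers on [n+1] chains would have rank at most [n], but it is triangular with
    nonzero diagonal. *)
Lemma column_infinite_dimensional : infinite_dimensional (rat_span (@column b t)).
Proof.
move=> n e _; apply: contrapT => none.
have span k : (0 < k)%N -> exists c : 'I_n -> rat, forall x, theta_power k x = \sum_(i < n) c i * e i x.
  move=> k0; apply: contrapT => nc; apply: none; exists (theta_power k) => //.
  exists 1%N, (fun=> theta_power k), (fun=> 1); split=> [_|x]; first exact: theta_power_column.
  by rewrite big_ord1 mul1r.
have [C hC] := choice (fun k : 'I_n.+1 => span k.+1 isT).
have [D hD] := choice (fun j : 'I_n.+1 => exists_chain j.+1).
pose M : 'M[rat]_n.+1 := \matrix_(i, j) theta_power i.+1 (cls b (D j)).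
have ME : M = (\matrix_(i < n.+1, l < n) C i l) *m (\matrix_(l < n, j < n.+1) e l (cls b (D j))).
  by apply/matrixP => i j; rewrite !mxE hC; apply: eq_bigr => l _; rewrite !mxE.
have trig : is_trig_mx M^T.
  apply/is_trig_mxP => i j ij; rewrite !mxE.
  by have [-> //] := theta_power_chain j.+1 (hD i) isT; rewrite ltnS.
have unit : M \in unitmx.
  rewrite unitmxE -det_tr (det_trig trig) unitfE; apply/prodf_neq0 => i _.
  by rewrite !mxE; have [_] := theta_power_chain 0 (hD i) isT.
have := mxrank_unit unit; have := mulmx_max_rank (\matrix_(i < n.+1, l < n) C i l) (\matrix_(l < n, j < n.+1) e l (cls b (D j))).
by rewrite -ME => h e'; rewrite e' ltnn in h.
Qed.

End Independence.

Theorem theorem15 (b : base) :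
  (forall (m : enat) (s : nat) (k t : 'I_s -> nat),
     injective k ->
     (forall j, (0 < k j)%N /\ ele (Some (k j)) m) ->
     vknot_invariant (fun D : gauss b => (theta_prod k t (Lambda m D))%:~R) /\
     exists F : chains b m,
       (exists v : {additive lattice_group b m (\sum_(j < s) t j)%N -> rat},
          forall x : chains b m, (pairing F x)%:~R = v (proj _ x)) /\
       (forall D : gauss b,
          theta_prod k t (Lambda m D) = pairing F (subdiagram_sum (Lambda m D)))) /\
  (forall t : nat, (0 < t)%N ->
     (forall (m : enat) (v : {additive lattice_group b m t -> rat}),
        vknot_invariant (lattice_map v) /\ kauffman_finite_type (lattice_map v)) /\
     infinite_dimensional (rat_span (@column b t))).
Proof.
split=> [m s k t _ k_le|t t_gt0]; last first.
  split=> [m v|]; last exact: column_infinite_dimensional.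
  by split; [exact: lattice_map_invariant | exact: lattice_map_finite_type].
have [v hv] := theta_formula_functional b t k_le.
split; last first.
  exists (theta_formula b m k t); split; first by exists v.
  by move=> D; exact: theta_prod_pairing.
move=> D D' eqD; rewrite !theta_prod_pairing !hv.
exact: (lattice_map_invariant v) eqD.
Qed.
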